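(* Let $\mathcal T_0$ be a finite conforming mesh of a bounded polygonal domain $\Omega\subset\mathbb R^2$. There is a constant $C_{\rm LEB}=C_{\rm LEB}(\mathcal T_0)$, depending only on $\mathcal T_0$, such that for every $L\ge 1$ and every sequence of meshes $\mathcal T_0,\mathcal T_1,\dots,\mathcal T_L$ and sets $\mathcal M_\ell\subseteq\mathcal T_\ell$ ($0\le\ell<L$) for which $\mathcal T_{\ell+1}=\mathtt{RefineLEB}(\mathcal T_\ell,\mathcal M_\ell)$ for $0\le \ell<L$ (for arbitrary admissible choices of longest edges and arbitrary serial orders of the marked sets in the algorithm), one has $$\#\mathcal T_L-\#\mathcal T_0\le C_{\rm LEB}\sum_{\ell=0}^{L-1}\#\mathcal M_\ell .$$
   Context: **Meshes.** A conforming mesh $\mathcal T$ is a finite family of closed nondegenerate triangles in $\mathbb R^2$ with pairwise disjoint interiors such that the intersection of two distinct triangles is empty, a common vertex, or a common complete edge; it is a mesh of the bounded polygonal domain $\Omega$ if $\overline\Omega=\bigcup_{K\in\mathcal T}K$. An edge of $\mathcal T$ is a boundary edge if it is contained in $\partial\Omega$, and an interior edge otherwise. A boundary edge belongs to a single triangle of $\mathcal T$; for an interior edge $e$ of $K\in\mathcal T$, $K^*$ denotes the unique triangle in $\mathcal T\setminus\{K\}$ sharing $e$. $\#A$ is the cardinality of a finite set $A$. **Bisection.** If $K=[v_0,v_1,v_2]$ is a triangle, $e=[v_0,v_1]$ is a longest edge of $K$ and $m$ is the midpoint of $e$, put $\operatorname{children}(K,e)=\{[v_0,m,v_2],[m,v_1,v_2]\}$.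 **Terminal-priority longest-edge propagation path (LEPP).** Given a conforming mesh $\mathcal T$ and $K_0\in\mathcal T$, construct a sequence recursively. At $K_j$ choose any longest edge $e_j$ of $K_j$. (i) If $e_j\subset\partial\Omega$, stop: the terminal edge is $e_j$ and the terminal set is $\mathcal S=\{K_j\}$. (ii) Otherwise, if $e_j$ is also a longest edge of the neighbor $K_j^*$ of $K_j$ across $e_j$, stop: the terminal edge is $e_j$ and the terminal set is $\mathcal S=\{K_j,K_j^*\}$. (iii) If $e_j$ is not a longest edge of $K_j^*$, set $K_{j+1}:=K_j^*$ and continue. The resulting sequence $(K_0,\dots,K_J)$ is a LEPP starting at $K_0$. **$\mathtt{RefineOneLEB}(\mathcal T,M)$** (for $\mathcal T$ conforming and $M\in\mathcal T$): set $\widehat{\mathcal T}\gets\mathcal T$. While $M\in\widehat{\mathcal T}$: construct a LEPP in $\widehat{\mathcal T}$ starting at $M$, with terminal edge $e$ and terminal set $\mathcal S$; set $\mathcal C\gets\bigcup_{K\in\mathcal S}\operatorname{children}(K,e)$ and $\widehat{\mathcal T}\gets(\widehat{\mathcal T}\setminus\mathcal S)\cup\mathcal C$. Return $\widehat{\mathcal T}$. **$\mathtt{RefineLEB}(\mathcal T,\mathcal M)$** (for $\mathcal T$ conforming and $\mathcal M=\{M_1,\dots,M_r\}\subseteq\mathcal T$ given in a fixed serial order): set $\mathcal T^+\gets\mathcal T$. For $i=1,\dots,r$: if $M_i\in\mathcal T^+$, set $\mathcal T^+\gets\mathtt{RefineOneLEB}(\mathcal T^+,M_i)$ (otherwise skip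 $M_i$). Return $\mathcal T^+$. *)

(* Defs.v *)
From HB Require Import structures.
From mathcomp Require Import all_boot all_order all_algebra finmap.
From mathcomp Require Import all_classical all_reals all_analysis.
Import Order.TTheory GRing.Theory Num.Theory.
Import numFieldNormedType.Exports.

Set Implicit Arguments.
Unset Strict Implicit.
Unset Printing Implicit Defensive.

Local Open Scope classical_set_scope.
Local Open Scope ring_scope.

Notation plane R := 'rV[R]_2.

(* A simplex (segment or triangle) is represented by the finite set of its
   vertices; the corresponding closed point set is its convex hull [hull].
   For nondegenerate triangles and segments this is a faithful encoding, the
   vertices being the extreme points of the hull. *)
Notation simplex R := {fset plane R}.
Notation mesh R := {fset simplex R}.

Section Geometry.
Variable R : realType.
Implicit Types (a b c v : plane R) (e K : simplex R) (Omega : set (plane R)).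

Definition hull K : set (plane R) :=
  [set x | exists w : plane R -> R,
     [/\ forall v, v \in K -> 0 <= w v,
         \sum_(v <- K) w v = 1
       & x = \sum_(v <- K) w v *: v]].

(* Euclidean distance; the library norm on row vectors is the max norm. *)
Definition edist a b : R := Num.sqrt (\sum_i (a 0 i - b 0 i) ^+ 2).

Definition triangle K : Prop :=
  exists a b c, K = [fset a; b; c]%fset /\
    (b 0 0 - a 0 0) * (c 0 1 - a 0 1) - (c 0 0 - a 0 0) * (b 0 1 - a 0 1) != 0.

Definition segment e : Prop := #|` e| = 2%N.

Definition edge_of e K : Prop := segment e /\ (e `<=` K)%fset.

(* The two vertices of a segment are listed in an arbitrary order, which is
   immaterial by symmetry of [edist]; see [edge_lengthE]. *)
Definition edge_length e : R := edist (nth 0 e 0%N) (nth 0 e 1%N).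

Definition longest_edge e K : Prop :=
  edge_of e K /\ forall e', edge_of e' K -> edge_length e' <= edge_length e.

Definition midpoint e : plane R := 2^-1 *: \sum_(v <- e) v.

(* If K = [v0, v1, v2] and e = [v0, v1], the child obtained for v = v1 is
   [v0, m, v2] and the one obtained for v = v0 is [m, v1, v2]. *)
Definition children K e : mesh R :=
  [fset (midpoint e |` (K `\ v))%fset | v in e]%fset.

Definition boundary Omega : set (plane R) := closure Omega `\` Omega°.

(* [regopen Omega], i.e. Omega is the interior of its closure, excludes slits,
   so that a boundary edge of a mesh of Omega belongs to a single triangle. *)
Definition polygonal_domain Omega : Prop :=
  [/\ open Omega, connected Omega, bounded_set Omega, regopen Omega
    & exists2 E : {fset simplex R}, (forall e, e \in E -> segment e)
        & boundary Omega = \bigcup_(e in [set` E]) hull e].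

End Geometry.

Section Meshes.
Variable R : realType.
Implicit Types (e K M : simplex R) (T S : mesh R).

Definition conforming T : Prop :=
  [/\ forall K, K \in T -> triangle K,
      forall K K', K \in T -> K' \in T -> K != K' ->
        (hull K)° `&` (hull K')° = set0
    & forall K K', K \in T -> K' \in T -> K != K' ->
        [\/ hull K `&` hull K' = set0,
            exists v, [/\ v \in K, v \in K' & hull K `&` hull K' = [set v]]
          | exists e, [/\ edge_of e K, edge_of e K'
                        & hull K `&` hull K' = hull e]]].

Definition mesh_of (Omega : set (plane R)) T : Prop :=
  conforming T /\ closure Omega = \bigcup_(K in [set` T]) hull K.

Definition boundary_edge (Omega : set (plane R)) e : Prop :=
  hull e `<=` boundary Omega.

(* K' is a triangle of T \ {K} sharing e; it is unique when T is a conforming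
   mesh of Omega and e is an interior edge of K. *)
Definition neighbor T K e K' : Prop := [/\ K' \in T, K' != K & edge_of e K'].

(* [lepp Omega T K e S]: some terminal-priority longest-edge propagation path
   in T starting at K has terminal edge e and terminal set S. *)
Inductive lepp (Omega : set (plane R)) T : simplex R -> simplex R -> mesh R -> Prop :=
| lepp_boundary K e :
    longest_edge e K -> boundary_edge Omega e ->
    lepp Omega T K e [fset K]%fset
| lepp_pair K K' e :
    longest_edge e K -> ~ boundary_edge Omega e ->
    neighbor T K e K' -> longest_edge e K' ->
    lepp Omega T K e [fset K; K']%fset
| lepp_step K K' e e' S :
    longest_edge e K -> ~ boundary_edge Omega e ->
    neighbor T K e K' -> ~ longest_edge e K' ->
    lepp Omega T K' e' S ->
    lepp Omega T K e' S.

Definition bisect T S e : mesh R :=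
  ((T `\` S) `|` \bigcup_(K <- S) children K e)%fset.

(* Input/output relation of the (nondeterministic) while loop. *)
Inductive refine_one_LEB (Omega : set (plane R)) M : mesh R -> mesh R -> Prop :=
| refine_one_done T :
    M \notin T -> refine_one_LEB Omega M T T
| refine_one_loop T T' e S :
    M \in T -> lepp Omega T M e S ->
    refine_one_LEB Omega M (bisect T S e) T' ->
    refine_one_LEB Omega M T T'.

Inductive refine_LEB_seq (Omega : set (plane R)) :
    seq (simplex R) -> mesh R -> mesh R -> Prop :=
| refine_nil T : refine_LEB_seq Omega [::] T T
| refine_mark M Ms T T' T'' :
    M \in T -> refine_one_LEB Omega M T T' ->
    refine_LEB_seq Omega Ms T' T'' ->
    refine_LEB_seq Omega (M :: Ms) T T''
| refine_skip M Ms T T' :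
    M \notin T -> refine_LEB_seq Omega Ms T T' ->
    refine_LEB_seq Omega (M :: Ms) T T'.

(* T' is a possible result of RefineLEB(T, MM), for some serial order s of the
   marked set MM. *)
Definition refine_LEB (Omega : set (plane R)) T (MM : {fset simplex R}) T' : Prop :=
  exists2 s : seq (simplex R), perm_eq s MM & refine_LEB_seq Omega s T T'.

Lemma edistC (a b : plane R) : edist a b = edist b a.
Proof.
congr Num.sqrt; apply: eq_bigr => i _.
by rewrite -sqrrN opprB.
Qed.

Lemma edge_lengthE (a b : plane R) :
  a != b -> edge_length [fset a; b]%fset = edist a b.
Proof.
move=> ab.
have p : perm_eq [fset a; b]%fset [:: a; b].
  apply: uniq_perm; [exact: fset_uniq|by rewrite /= inE ab|].
  by move=> x; rewrite in_fset2 !inE.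
rewrite /edge_length.
have [->|->] : enum_fset [fset a; b]%fset = [:: a; b] \/
               enum_fset [fset a; b]%fset = [:: b; a].
  case: (enum_fset _) p => [|x [|y [|z s]]] p; try by have := perm_size p.
  have := perm_mem p x; have := perm_mem p y; have := perm_uniq p.
  rewrite /= !inE !eqxx ?orbT /= ab !andbT => xy.
  move=> /esym/orP[]/eqP yE /esym/orP[]/eqP xE; move: xy; rewrite xE yE ?eqxx //.
    by right.
  by left.
- by [].
- exact: edistC.
Qed.

Lemma midpointE (a b : plane R) :
  a != b -> midpoint [fset a; b]%fset = 2^-1 *: (a + b).
Proof.
move=> ab; rewrite /midpoint; congr (_ *: _).
by rewrite big_fsetU1 ?inE //= big_seq_fset1.
Qed.

Lemma childrenE (v0 v1 v2 : plane R) : v0 != v1 -> v0 != v2 -> v1 != v2 ->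
  let m := 2^-1 *: (v0 + v1) in
  children [fset v0; v1; v2]%fset [fset v0; v1]%fset =
    [fset [fset v0; m; v2]; [fset m; v1; v2]]%fset.
Proof.
move=> v01 v02 v12 m; rewrite /children midpointE // -/m.
have E0 : (m |` ([fset v0; v1; v2] `\ v0) = [fset m; v1; v2])%fset.
  apply/fsetP => x; rewrite !inE.
  case: (eqVneq x v0) => [->|_] /=; last by rewrite orbA.
  by rewrite (negbTE v01) (negbTE v02) !orbF.
have E1 : (m |` ([fset v0; v1; v2] `\ v1) = [fset v0; m; v2])%fset.
  apply/fsetP => x; rewrite !inE.
  case: (eqVneq x v1) => [->|_] /=; last by rewrite orbF orbA (orbC (x == m)).
  by rewrite eq_sym (eq_sym v1) (negbTE v01) (negbTE v12) !orbF.
by rewrite imfsetU1 imfset_fset1 E0 E1 fsetUC.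
Qed.

End Meshes.

(* Main.v *)
Require Import Defs.
From mathcomp Require Import all_boot all_order all_algebra finmap.
From mathcomp Require Import all_classical all_reals all_analysis.
From mathcomp Require Import ring lra zify.
Import Order.TTheory GRing.Theory Num.Theory.
Import numFieldNormedType.Exports.

(** Longest-edge bisection of a triangle produces finitely many shapes, ties
    included: scaling the squared sides [x >= y >= z] by 2 per generation keeps
    the area fixed, and the two children have squared sides [2 y, x / 2, w] and
    [2 z, x / 2, w], where [w = y + z - x / 2]. The children of a child bisected
    again at an old side are the triangle itself and its flip [2 w, y, z], so only
    boundedly many steps leave this family. Hence diameters and areas of all
    elements are of the form [s / sqrt 2 ^ k] and [(d / sqrt 2 ^ k) ^ 2] with [s]
    and [d] in finite sets, and all elements are shape regular.

    Along a propagation path diameters strictly increase, so by the discreteness of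
    their values they add up to at most a multiple of the last one. An element [K]
    bisected on behalf of the marked element [M] therefore satisfies
    [diam M <= diam K] and [dist K M <= C * diam K].

    The count is amortized as by Binev, Dahmen and DeVore: each marked [M] pays
    [diam M / diam K] to every bisected [K] within distance [radius * diam K] and
    with [diam M <= 2 * diam K]. A marked element pays a bounded total: bisected
    elements of equal area have disjoint interiors, so few of them lie near [M],
    and the payments decay geometrically in the size. A bisected element receives
    at least a fixed amount: follow the chain from [M] to the marked element whose
    treatment created [M], and so on back to the initial mesh. *)

Set Implicit Arguments.
Unset Strict Implicit.
Unset Printing Implicit Defensive.

Local Open Scope classical_set_scope.
Local Open Scope ring_scope.

(* [edist] is also the name of an extended distance in MathComp-Analysis. *)
Local Notation edist := Defs.edist.

(** * Shapes *)

Section Triples.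
Variable R : realType.
Implicit Types (x y z : R) (t : seq R).

Definition srt x y z : seq R := sort (fun a b => b <= a) [:: x; y; z].

Let ge_total : total (fun a b : R => b <= a).
Proof. by move=> a b; rewrite orbC le_total. Qed.
Let ge_trans : transitive (fun a b : R => b <= a).
Proof. by move=> b a c ab bc; apply: le_trans bc ab. Qed.
Let ge_anti : antisymmetric (fun a b : R => b <= a).
Proof. by move=> a b /andP[ba ab]; apply/le_anti; rewrite ab ba. Qed.

Lemma srt_perm x y z x' y' z' :
  perm_eq [:: x; y; z] [:: x'; y'; z'] -> srt x y z = srt x' y' z'.
Proof. by move/(perm_sortP ge_total ge_trans ge_anti). Qed.

Lemma srt_sorted x y z : y <= x -> z <= y -> srt x y z = [:: x; y; z].
Proof. by move=> yx zy; apply: (sorted_sort ge_trans); rewrite /= yx zy. Qed.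

Lemma srtC12 x y z : srt x y z = srt y x z.
Proof. by apply: srt_perm; apply/permP => p /=; rewrite addnCA. Qed.

Lemma srtC23 x y z : srt x y z = srt x z y.
Proof. by apply: srt_perm; apply/permP => p /=; rewrite (addnCA (p y)). Qed.

Lemma mem_srt x y z : srt x y z =i [:: x; y; z].
Proof. exact: mem_sort. Qed.

Lemma srt_max x y z u1 u2 u3 : y <= x -> z <= x ->
  srt x y z = [:: u1; u2; u3] ->
  x = u1 /\ ((y = u2 /\ z = u3) \/ (y = u3 /\ z = u2)).
Proof.
move=> yx zx; case: (leP z y) => zy; first by rewrite srt_sorted // => -[-> -> ->]; split=> //; left.
by rewrite srtC23 (srt_sorted zx (ltW zy)) => -[-> -> ->]; split=> //; right.
Qed.

(* The entries are the squared sides of a triangle of generation [g], multiplied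
   by [2 ^ g]; for a longest side [x] the step leads to the child keeping the side
   [y], whose third side is the median. *)
Inductive reach t : seq R -> Prop :=
| reach_refl : reach t t
| reach_step x y z : y <= x -> z <= x -> reach t (srt x y z) ->
    reach t (srt (2 * y) (x / 2) (y + z - x / 2)).

Definition fin_reach t := exists F : seq (seq R), forall u, reach t u -> u \in F.

Lemma fin_reach_seq (U : seq (seq R)) : (forall u, u \in U -> fin_reach u) ->
  exists F : seq (seq R), forall u v, u \in U -> reach u v -> v \in F.
Proof.
elim: U => [|u U IH] HU; first by exists [::].
have [F HF] := IH (fun v vU => HU v (mem_behead (s := u :: U) vU)).
have [F' HF'] := HU u (mem_head _ _).
exists (F ++ F') => v w; rewrite inE mem_cat => /orP[/eqP-> /HF' ->|vU vw].
  by rewrite orbT.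
by rewrite (HF v).
Qed.

(** A derivation from [G] stays in [G] or enters [U], where the finite set for [U] takes over. Ties
    are harmless: by [srt_max], any chosen longest entry has the value at the head of the list. *)
Lemma fin_reach_closed (G U : seq (seq R)) :
  (forall u, u \in U -> fin_reach u) ->
  (forall u, u \in G -> exists x y z, [/\ u = [:: x; y; z],
     srt (2 * y) (x / 2) (y + z - x / 2) \in G ++ U &
     srt (2 * z) (x / 2) (y + z - x / 2) \in G ++ U]) ->
  forall t, t \in G -> fin_reach t.
Proof.
move=> /fin_reach_seq[F HF] HG t tG; exists (G ++ F) => u tu.
suff : u \in G \/ exists2 v, v \in U & reach v u.
  by move=> [uG|[v vU vu]]; rewrite mem_cat ?uG // (HF v) ?orbT.
elim: tu => [|x y z yx zx _ [/HG [x' [y' [z' [E Hb Hc]]]]|[v vU vu]]]; first by left.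
- have [-> H] := srt_max yx zx E.
  have : srt (2 * y) (x' / 2) (y + z - x' / 2) \in G ++ U.
    by case: H => -[-> ->] //; rewrite (addrC z').
  rewrite mem_cat => /orP[|H']; [by left|right].
  by eexists; [exact: H'|exact: reach_refl].
- by right; exists v => //; apply: reach_step.
Qed.

(* 16 times the squared area. *)
Definition heron x y z := 4 * (y * z) - (y + z - x) ^+ 2.

Lemma heron_bound x y z : 0 < heron x y z -> 0 < y -> 0 < z.
Proof.
rewrite /heron => H y0; have : 0 < 4 * (y * z).
  by apply: lt_le_trans H _; rewrite lerBlDr lerDl sqr_ge0.
by rewrite pmulr_rgt0 // pmulr_rgt0.
Qed.

(** By the parallelogram law, [x] and [2 * (y + z - x / 2)] are the squared diagonals of a
    parallelogram with squared sides [y] and [z]; either diagonal halves its area. *)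
Lemma heron_flip x y z : heron (2 * (y + z - x / 2)) y z = heron x y z.
Proof. by rewrite /heron; field. Qed.

Lemma heron_child x y z : heron (2 * y) (x / 2) (y + z - x / 2) = heron x y z.
Proof. by rewrite /heron; field. Qed.

Lemma heronC12 x y z : heron x y z = heron y x z.
Proof. by rewrite /heron; ring. Qed.

Lemma heronC23 x y z : heron x y z = heron x z y.
Proof. by rewrite /heron; ring. Qed.

(** Acuteness gives [x / 2 <= w], and [w <= 2 * z] makes the doubled old side the longest one in
    both children. Bisecting there yields the triangle or its flip, and the flip has the same two
    children. *)
Lemma fin_reach_acute_return x y z (w := y + z - x / 2) :
  0 < z -> z <= y -> y <= x ->
  x <= y + z -> w <= 2 * z -> fin_reach [:: x; y; z].
Proof.
move=> z0 zy yx ac; rewrite {1}/w => wz.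
have E1 : srt (2 * y) (x / 2) w = [:: 2 * y; w; x / 2].
  by rewrite srtC23 srt_sorted // /w; lra.
have E2 : srt (2 * z) (x / 2) w = [:: 2 * z; w; x / 2].
  by rewrite srtC23 srt_sorted // /w; lra.
have E3 : srt (2 * w) y z = [:: 2 * w; y; z] by rewrite srt_sorted // /w; lra.
have E4 : srt x y z = [:: x; y; z] by rewrite srt_sorted.
apply: (@fin_reach_closed [:: [:: x; y; z]; [:: 2 * w; y; z];
   [:: 2 * y; w; x / 2]; [:: 2 * z; w; x / 2]] [::]) => // [u|]; last first.
  by rewrite mem_head.
rewrite cats0 -E1 -E2 -E3 -E4 !inE => /or4P[]/eqP->; rewrite ?E1 ?E2 ?E3 ?E4.
- by exists x, y, z; rewrite -/w E1 E2 !inE !eqxx !orbT.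
- exists (2 * w), y, z; have -> : 2 * w / 2 = w by field.
  have -> : y + z - w = x / 2 by rewrite /w; field.
  by rewrite (srtC23 (2 * y)) (srtC23 (2 * z)) E1 E2 !inE !eqxx !orbT.
- exists (2 * y), w, (x / 2); have -> : 2 * y / 2 = y by field.
  have -> : w + x / 2 - y = z by rewrite /w; field.
  have -> : 2 * (x / 2) = x by field.
  by rewrite E3 E4 !inE !eqxx !orbT.
- exists (2 * z), w, (x / 2); have -> : 2 * z / 2 = z by field.
  have -> : w + x / 2 - z = y by rewrite /w; field.
  have -> : 2 * (x / 2) = x by field.
  by rewrite (srtC23 (2 * w)) (srtC23 x) E3 E4 !inE !eqxx !orbT.
Qed.

(** Without [w <= 2 * z] only the child keeping [z] can leave the closed family; in the other child
    [2 * y] is longest anyway. *)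
Lemma fin_reach_acute_leave x y z (w := y + z - x / 2) :
  0 < z -> z <= y -> y <= x ->
  x <= y + z -> fin_reach (srt (2 * z) (x / 2) w) -> fin_reach [:: x; y; z].
Proof.
move=> z0 zy yx ac Hc.
have E1 : srt (2 * y) (x / 2) w = [:: 2 * y; w; x / 2].
  by rewrite srtC23 srt_sorted // /w; lra.
have E3 : srt (2 * w) y z = [:: 2 * w; y; z] by rewrite srt_sorted // /w; lra.
have E4 : srt x y z = [:: x; y; z] by rewrite srt_sorted.
apply: (@fin_reach_closed [:: [:: x; y; z]; [:: 2 * w; y; z];
   [:: 2 * y; w; x / 2]] [:: srt (2 * z) (x / 2) w]) => [u|u|]; last first.
- by rewrite mem_head.
- rewrite -E1 -E3 -E4 => /[!inE]/or3P[]/eqP->; rewrite ?E1 ?E3 ?E4.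
  + by exists x, y, z; rewrite -/w E1 !inE !eqxx !orbT.
  + exists (2 * w), y, z; have -> : 2 * w / 2 = w by field.
    have -> : y + z - w = x / 2 by rewrite /w; field.
    by rewrite (srtC23 (2 * y)) (srtC23 (2 * z) w) E1 !inE !eqxx !orbT.
  + exists (2 * y), w, (x / 2); have -> : 2 * y / 2 = y by field.
    have -> : w + x / 2 - y = z by rewrite /w; field.
    have -> : 2 * (x / 2) = x by field.
    by rewrite E3 E4 !inE !eqxx !orbT.
- by rewrite inE => /eqP->.
Qed.

(** The child keeping [y] leads back to the triangle or to its flip, and so does the child keeping
    [z] unless [4 * z < x]. The flip is an exit, since its longest side need not be [2 * w]. *)
Lemma fin_reach_obtuse x y z (w := y + z - x / 2) :
  0 < z -> z <= y -> y <= x -> 0 < heron x y z -> y + z <= x ->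
  fin_reach (srt (2 * w) y z) ->
  (4 * z <= x -> fin_reach (srt (2 * z) (x / 2) w)) -> fin_reach [:: x; y; z].
Proof.
move=> z0 zy yx D0 ob Hf Hc.
have wx : w <= x / 2 by rewrite /w; lra.
(* Otherwise both short sides are below half the longest one, against the triangle inequality
   encoded by [heron]. *)
have y2 : x / 2 <= 2 * y.
  rewrite leNgt; apply/negP => H; move: D0; rewrite ltNge => /negP; apply.
  by rewrite /heron; nra.
have E1 : srt (2 * y) (x / 2) w = [:: 2 * y; x / 2; w] by rewrite srt_sorted.
have E4 : srt x y z = [:: x; y; z] by rewrite srt_sorted.
have [z2|z2] := leP (x / 2) (2 * z).
- have E2 : srt (2 * z) (x / 2) w = [:: 2 * z; x / 2; w] by rewrite srt_sorted.
  apply: (@fin_reach_closed [:: [:: x; y; z]; [:: 2 * y; x / 2; w];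
    [:: 2 * z; x / 2; w]] [:: srt (2 * w) y z]) => [u|u|]; last first.
  + by rewrite mem_head.
  + rewrite -E1 -E2 -E4 => /[!inE]/or3P[]/eqP->; rewrite ?E1 ?E2 ?E4.
    * by exists x, y, z; rewrite -/w E1 E2 !inE !eqxx !orbT.
    * exists (2 * y), (x / 2), w; have -> : 2 * y / 2 = y by field.
      have -> : x / 2 + w - y = z by rewrite /w; field.
      have -> : 2 * (x / 2) = x by field.
      by rewrite E4 !inE !eqxx !orbT.
    * exists (2 * z), (x / 2), w; have -> : 2 * z / 2 = z by field.
      have -> : x / 2 + w - z = y by rewrite /w; field.
      have -> : 2 * (x / 2) = x by field.
      by rewrite (srtC23 (2 * w)) (srtC23 x) E4 !inE !eqxx !orbT.
  + by rewrite inE => /eqP->.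
- apply: (@fin_reach_closed [:: [:: x; y; z]; [:: 2 * y; x / 2; w]]
    [:: srt (2 * w) y z; srt (2 * z) (x / 2) w]) => [u|u|]; last first.
  + by rewrite mem_head.
  + rewrite -E1 -E4 => /[!inE]/orP[]/eqP->; rewrite ?E1 ?E4.
    * by exists x, y, z; rewrite -/w E1 !inE !eqxx !orbT.
    * exists (2 * y), (x / 2), w; have -> : 2 * y / 2 = y by field.
      have -> : x / 2 + w - y = z by rewrite /w; field.
      have -> : 2 * (x / 2) = x by field.
      by rewrite E4 !inE !eqxx !orbT.
  + by rewrite in_cons inE => /orP[]/eqP-> //; apply: Hc; lra.
Qed.

Lemma fin_reach_srt (Q : R -> R -> R -> Prop) :
  (forall x y z, Q x y z -> Q y x z) -> (forall x y z, Q x y z -> Q x z y) ->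
  (forall x y z, z <= y -> y <= x -> Q x y z -> fin_reach [:: x; y; z]) ->
  forall x y z, Q x y z -> fin_reach (srt x y z).
Proof.
move=> Q12 Q23 H x y z.
wlog yx : x y / y <= x => [W|q].
  by case: (leP y x) => [/W|/ltW/W {}W /Q12]; [apply|rewrite srtC12; apply: W].
case: (leP z y) => [zy|/ltW yz]; first by rewrite srt_sorted //; apply: H.
rewrite srtC23; case: (leP z x) => [zx|/ltW xz].
  by rewrite srt_sorted //; apply: H => //; apply: Q23.
by rewrite srtC12 srt_sorted //; apply: H => //; apply/Q12/Q23.
Qed.

Lemma heron_pos x y z : 0 < heron x y z -> 0 < x -> 0 < y /\ 0 < z.
Proof.
move=> D0 x0; split.
  by apply: (@heron_bound z x y) => //; rewrite heronC12 heronC23.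
by apply: (@heron_bound y x z) => //; rewrite heronC12.
Qed.

Lemma fin_reach_triangle x y z :
  0 < x -> 0 < heron x y z -> fin_reach (srt x y z).
Proof.
move=> x0 D0; have [y0 z0] := heron_pos D0 x0.
pose Q u v w := [/\ 0 < u, 0 < v, 0 < w & 0 < heron u v w].
apply: (@fin_reach_srt Q) => // [u v w [? ? ? D]|u v w [? ? ? D]|];
  first by split=> //; rewrite heronC12.
  by split=> //; rewrite heronC23.
move=> {x0 D0 y0 z0} {}x {}y {}z zy yx [L0 _ _ D0].
(* [eps] is a lower bound for the smallest side at fixed area and largest side at
   most [L]; leaving a family lowers the largest side by at least [eps], except
   when an obtuse triangle flips to an acute one (hence [acute] comes first) and
   in the acute case [a <= 4 * c], after which every child returns. *)
pose L := x; pose eps := heron x y z / (4 * L).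
have eps0 : 0 < eps by rewrite divr_gt0 // mulr_gt0.
suff main n : forall x' y' z', z' <= y' -> y' <= x' -> 0 < x' ->
    heron x' y' z' = heron x y z -> x' <= L -> x' <= n%:R * eps ->
    fin_reach [:: x'; y'; z'].
  apply: (main (Num.truncn (L / eps)).+1) => //.
  by rewrite -ler_pdivrMr // ltW // truncnS_gt.
elim: n => [|n IH] {zy yx} {}x' {}y' {}z' zy yx x0 E xL xn.
  by move: xn; rewrite mul0r => xn; exfalso; lra.
have {}xn : x' - eps <= n%:R * eps by rewrite lerBlDr -{2}[eps]mul1r -mulrDl natr1.
have D0' : 0 < heron x' y' z' by rewrite E.
(* [heron a b c <= 4 * (b * c) <= 4 * (L * c)]. *)
have low a b c : heron a b c = heron x' y' z' -> b <= x' -> 0 < c -> eps <= c.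
  move=> Ea bx c0; rewrite ler_pdivrMr; last by rewrite mulr_gt0.
  have : 0 <= (L - b) * c by rewrite mulr_ge0 //; lra.
  by rewrite -E -Ea /heron; have := sqr_ge0 (b + c - a); nra.
have [y0 z0] := heron_pos D0' x0.
have {}IH u v w : 0 < u -> heron u v w = heron x' y' z' ->
    u <= x' - eps -> v <= x' - eps -> w <= x' - eps -> fin_reach (srt u v w).
  move=> u0 E' ul vl wl.
  pose Q' a b c := [/\ 0 < a, 0 < b, 0 < c & heron a b c = heron x y z /\
     [/\ a <= x' - eps, b <= x' - eps & c <= x' - eps]].
  apply: (@fin_reach_srt Q') => [a b c|a b c|a b c cb ba [a0 b0 c0 [Ea [al bl cl]]]|].
  - by move=> [? ? ? [? []]]; split=> //; split=> //; rewrite heronC12.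
  - by move=> [? ? ? [? []]]; split=> //; split=> //; rewrite heronC23.
  - by apply: IH => //; lra.
  - have D : 0 < heron u v w by rewrite E'.
    by have [? ?] := heron_pos D u0; split=> //; rewrite -E.
have acute a b c : c <= b -> b <= a -> 0 < a -> heron a b c = heron x' y' z' ->
    a <= x' -> a <= b + c -> fin_reach [:: a; b; c].
  move=> cb ba a0 Ea ax ac.
  have Da : 0 < heron a b c by rewrite Ea.
  have [b0 c0] := heron_pos Da a0.
  have ec : eps <= c by apply: low Ea _ c0; lra.
  case: (leP (b + c - a / 2) (2 * c)) => [wc|cw]; first exact: fin_reach_acute_return.
  apply: fin_reach_acute_leave => //; case: (ltP (4 * c) a) => c4.
    apply: IH; [lra| |lra|lra|lra].
    by rewrite (addrC b) heron_child -heronC23.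
  (* Now [b + c - a / 2] is the longest side of this child, which itself meets the return
     condition. *)
  rewrite srtC23 srtC12 srt_sorted; [|lra|lra].
  by apply: fin_reach_acute_return; lra.
case: (leP x' (y' + z')) => [|ob]; first by apply: acute.
have Ef := heron_flip x' y' z'; have Ec := heron_child x' z' y'.
have ez : eps <= z' by apply: low z0; [reflexivity|].
apply: fin_reach_obtuse => //; first exact: ltW.
  (* Either all sides of the flip are at most [y' <= x' - eps], or its longest side is the new one
     and it is acute. *)
  case: (leP (2 * (y' + z' - x' / 2)) y') => yW.
    by rewrite srtC12; apply: IH; rewrite -?Ef -1?heronC12 //; lra.
  by rewrite srt_sorted //; [apply: acute => //; lra|exact: ltW].
move=> z4; apply: IH; [lra| |lra|lra|lra].
by rewrite (addrC y') Ec heronC23.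
Qed.

End Triples.

(** * Diameter and area *)

Section Plane.
Variable R : realType.
Implicit Types (a b c v x : plane R) (e K N : simplex R).

Definition seqmax (l : seq R) := foldr Num.max 0 l.

Lemma seqmax_ge0 l : 0 <= seqmax l.
Proof. by elim: l => //= x l IH; rewrite le_max IH orbT. Qed.

Lemma seqmax_ge l r : r \in l -> r <= seqmax l.
Proof.
elim: l => //= x l IH; rewrite inE le_max => /orP[/eqP->|/IH ->]; rewrite ?lexx //.
by rewrite orbT.
Qed.

Lemma seqmax_le l r : 0 <= r -> (forall s, s \in l -> s <= r) -> seqmax l <= r.
Proof.
move=> r0; elim: l => //= x l IH H; rewrite ge_max H ?mem_head //=.
by apply: IH => s sl; apply: H; rewrite inE sl orbT.
Qed.

Lemma seqmax_mem l : seqmax l = 0 \/ seqmax l \in l.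
Proof.
elim: l => [|x l IH] /=; first by left.
rewrite /Num.max; case: ifP => _; last by right; rewrite mem_head.
by case: IH => [->|H]; [left|right; rewrite inE H orbT].
Qed.

Definition sqdist a b : R := (a 0 0 - b 0 0) ^+ 2 + (a 0 1 - b 0 1) ^+ 2.

Definition det3 a b c : R :=
  (b 0 0 - a 0 0) * (c 0 1 - a 0 1) - (c 0 0 - a 0 0) * (b 0 1 - a 0 1).

Lemma edistE a b : edist a b = Num.sqrt (sqdist a b).
Proof.
rewrite /edist /sqdist !big_ord_recl big_ord0 addr0.
by rewrite (_ : lift ord0 ord0 = 1) //; apply/val_inj.
Qed.

Lemma sqdist_ge0 a b : 0 <= sqdist a b.
Proof. by rewrite addr_ge0 ?sqr_ge0. Qed.

Lemma edist_ge0 a b : 0 <= edist a b.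
Proof. exact: sqrtr_ge0. Qed.

Lemma sqr_edist a b : edist a b ^+ 2 = sqdist a b.
Proof. by rewrite edistE sqr_sqrtr // sqdist_ge0. Qed.

Lemma coord_le_norm x (i : 'I_2) : `|x 0 i| <= `|x|.
Proof. by rewrite [ `|x| ]mx_normrE; apply: (le_bigmax _ _ (0, i)). Qed.

Lemma norm_leP x r : 0 <= r -> `|x 0 0| <= r -> `|x 0 1| <= r -> `|x| <= r.
Proof.
move=> r0 x0 x1; rewrite [ `|x| ]mx_normrE; apply: bigmax_le => // -[i j] _ /=.
rewrite (ord1 i); case: j => -[|[|//]] j /=.
  by rewrite (_ : Ordinal j = 0) //; apply/val_inj.
by rewrite (_ : Ordinal j = 1) //; apply/val_inj.
Qed.

Lemma norm_le_edist a b : `|a - b| <= edist a b.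
Proof.
apply: norm_leP; rewrite ?edist_ge0 // !mxE edistE -sqrtr_sqr ler_sqrt ?sqdist_ge0 //.
  by rewrite lerDl sqr_ge0.
by rewrite lerDr sqr_ge0.
Qed.

Lemma plane_eq a b : a 0 0 = b 0 0 -> a 0 1 = b 0 1 -> a = b.
Proof.
move=> H0 H1; apply/rowP => -[[|[|//]] j].
  by rewrite (_ : Ordinal j = 0) //; apply/val_inj.
by rewrite (_ : Ordinal j = 1) //; apply/val_inj.
Qed.

Definition diam K : R := seqmax [seq edist a b | a <- K, b <- K].

Lemma diam_ge K a b : a \in K -> b \in K -> edist a b <= diam K.
Proof. by move=> aK bK; apply: seqmax_ge; apply/allpairsP; exists (a, b). Qed.

Lemma diam_ge0 K : 0 <= diam K.
Proof. exact: seqmax_ge0. Qed.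

Lemma diam_mem K : K != fset0 ->
  exists a b, [/\ a \in K, b \in K & diam K = edist a b].
Proof.
case/fset0Pn => v vK; case: (seqmax_mem [seq edist a b | a <- K, b <- K]).
  move=> K0; exists v, v; split=> //; rewrite [LHS]K0.
  by apply/esym/eqP; rewrite edistE /sqdist !subrr expr0n addr0 sqrtr0.
by case/allpairsP => -[a b] [aK bK E]; exists a, b.
Qed.

(** Twice the Euclidean area; the maximum over vertex triples makes it independent of their
    order. *)
Definition area K : R :=
  seqmax [seq `|det3 p.1 p.2 c| | p <- [seq (a, b) | a <- K, b <- K], c <- K].

Lemma det3_rot a b c : det3 b c a = det3 a b c.
Proof. by rewrite /det3; ring. Qed.

Lemma det3C12 a b c : det3 b a c = - det3 a b c.
Proof. by rewrite /det3; ring. Qed.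

Lemma det3C23 a b c : det3 a c b = - det3 a b c.
Proof. by rewrite /det3; ring. Qed.

Lemma det3C13 a b c : det3 c b a = - det3 a b c.
Proof. by rewrite /det3; ring. Qed.

Lemma det3aab a c : det3 a a c = 0.
Proof. by rewrite /det3; ring. Qed.

Lemma det3abb a b : det3 a b b = 0.
Proof. by rewrite /det3; ring. Qed.

Lemma det3aba a b : det3 a b a = 0.
Proof. by rewrite /det3; ring. Qed.

Lemma det3_neq a b c : det3 a b c != 0 -> [/\ a != b, a != c & b != c].
Proof. by move=> D; split; apply: contraNneq D => ->; rewrite ?(det3aab, det3aba, det3abb). Qed.

Lemma areaE a b c : area [fset a; b; c]%fset = `|det3 a b c|.
Proof.
apply/le_anti/andP; split.
  apply: seqmax_le => // s /allpairsP[[[p q] r] /= [/allpairsP[[p' q'] /= []]]].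
  move=> pK qK [-> ->] rK ->; suff [->|[->|->]] : det3 p' q' r = det3 a b c \/
      det3 p' q' r = - det3 a b c \/ det3 p' q' r = 0 by rewrite ?normrN ?normr0.
  move: pK qK rK; rewrite !inE.
  move=> /orP[/orP[]|]/eqP-> /orP[/orP[]|]/eqP-> /orP[/orP[]|]/eqP->; 
    first [ by left | by left; rewrite det3_rot | by left; rewrite -det3_rot
      | by right; left; rewrite det3C12 | by right; left; rewrite det3C23
      | by right; left; rewrite det3C13
      | by right; right; rewrite det3aab | by right; right; rewrite det3abb
      | by right; right; rewrite det3aba ].
apply: seqmax_ge; apply/allpairsP; exists ((a, b), c); split=> //=.
- by apply/allpairsP; exists (a, b); rewrite !inE !eqxx ?orbT.
- by rewrite !inE eqxx !orbT.
Qed.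

Lemma triangle_third K a b : triangle K -> a \in K -> b \in K -> a != b ->
  exists c, K = [fset a; b; c]%fset /\ det3 a b c != 0.
Proof.
move=> [p [q [r [-> D]]]]; rewrite -/(det3 p q r) in D.
rewrite !inE => /orP[/orP[]|]/eqP-> /orP[/orP[]|]/eqP->; rewrite ?eqxx //= => _.
- by exists r.
- exists q; split; last by rewrite det3C23 oppr_eq0.
  by apply/fsetP => x; rewrite !inE; case: (x == p); case: (x == q); case: (x == r).
- exists r; split; last by rewrite det3C12 oppr_eq0.
  by apply/fsetP => x; rewrite !inE; case: (x == p); case: (x == q); case: (x == r).
- exists p; split; last by rewrite det3_rot.
  by apply/fsetP => x; rewrite !inE; case: (x == p); case: (x == q); case: (x == r).
- exists q; split; last by rewrite -det3_rot.
  by apply/fsetP => x; rewrite !inE; case: (x == p); case: (x == q); case: (x == r).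
- exists p; split; last by rewrite det3C13 oppr_eq0.
  by apply/fsetP => x; rewrite !inE; case: (x == p); case: (x == q); case: (x == r).
Qed.

Lemma triangle_neq0 K : triangle K -> K != fset0.
Proof.
move=> [a [b [c [-> _]]]]; apply/fset0Pn; exists a.
by rewrite !inE eqxx.
Qed.

Lemma segmentP e : segment e -> exists a b, a != b /\ e = [fset a; b]%fset.
Proof.
rewrite /segment => e2.
have /fset0Pn[a ae] : e != fset0 by rewrite -cardfs_gt0 e2.
move: e2; rewrite (cardfsD1 a) ae add1n => -[e1].
have /fset0Pn[b be] : (e `\ a)%fset != fset0 by rewrite -cardfs_gt0 e1.
move: e1; rewrite (cardfsD1 b) be add1n => -[/eqP]; rewrite cardfs_eq0 => /eqP e0.
exists a, b; split; first by move: be; rewrite !inE eq_sym => /andP[].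
by rewrite -(fsetD1K ae) -(fsetD1K be) e0 fsetU0.
Qed.

Lemma edge_length_le_diam e K : edge_of e K -> edge_length e <= diam K.
Proof.
move=> [/segmentP[a [b [ab ->]]] /fsubsetP eK].
by rewrite edge_lengthE // diam_ge // eK // !inE eqxx ?orbT.
Qed.

Lemma longest_edge_of_diam e K : edge_of e K -> diam K <= edge_length e -> longest_edge e K.
Proof.
by move=> eK H; split=> // e' /edge_length_le_diam e'K; apply: le_trans e'K H.
Qed.

Lemma longest_edge_diam e K : longest_edge e K -> edge_length e = diam K.
Proof.
move=> [eK H]; apply/le_anti; rewrite edge_length_le_diam //=.
have [[a [b [ab ee]]] /fsubsetP sub] := (segmentP eK.1, eK.2).
have aK : a \in K by apply: sub; rewrite ee !inE eqxx.
have [|p [q [pK qK ->]]] := @diam_mem K; first by apply/fset0Pn; exists a.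
case: (eqVneq p q) => [->|pq].
  by rewrite edistE /sqdist !subrr expr0n addr0 sqrtr0 ee edge_lengthE // edist_ge0.
rewrite -edge_lengthE //; apply: H; split.
  by rewrite /segment cardfs2 pq.
by apply/fsubsetP => x; rewrite !inE => /orP[]/eqP->.
Qed.

Definition mid a b : plane R := 2^-1 *: (a + b).

(** The endpoint of [e] that the child retains is named [a], so both children take the same form. *)
Lemma children_triangle K e N : triangle K -> longest_edge e K -> N \in children K e ->
  exists a b c, [/\ K = [fset a; b; c]%fset, det3 a b c != 0, edist a b = diam K,
    e = [fset a; b]%fset & N = [fset a; mid a b; c]%fset].
Proof.
move=> tK eK; have := longest_edge_diam eK; case: (eK) => -[/segmentP[a [b [ab ->]]] /fsubsetP sub] _.
rewrite edge_lengthE // => abK.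
have [|||c [EK D]] := @triangle_third K a b tK; rewrite ?sub ?inE ?eqxx ?orbT //.
have [_ ac bc] := det3_neq D; rewrite EK childrenE // in_fset2 => /orP[]/eqP->.
  by exists a, b, c; split; rewrite -?EK.
have EK' : K = [fset b; a; c]%fset by rewrite EK (fsetUC [fset b]%fset).
exists b, a, c; split.
- by rewrite -EK.
- by rewrite det3C12 oppr_eq0.
- by rewrite -EK Defs.edistC.
- exact: fsetUC.
- by rewrite /mid (addrC b) (fsetUC [fset b]%fset).
Qed.

Lemma card_children K e : segment e -> (#|` children K e| <= 2)%N.
Proof. by move=> e2; apply: leq_trans (_ : #|` e| <= 2)%N; [exact: leq_imfset_card|rewrite e2]. Qed.

Lemma midE0 a b i : mid a b 0 i = (a 0 i + b 0 i) / 2.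
Proof. by rewrite !mxE mulrC. Qed.

Lemma sqdistC a b : sqdist a b = sqdist b a.
Proof. by rewrite /sqdist; ring. Qed.

Lemma sqdist_mid a b : sqdist a (mid a b) = sqdist a b / 4.
Proof. by rewrite /sqdist !midE0; field. Qed.

Lemma sqdist_median a b c :
  sqdist (mid a b) c = (sqdist a c + sqdist b c - sqdist a b / 2) / 2.
Proof. by rewrite /sqdist !midE0; field. Qed.

Lemma det3_mid a b c : det3 a (mid a b) c = det3 a b c / 2.
Proof. by rewrite /det3 !midE0; field. Qed.

(** Heron's formula in squared sides, [det3] being twice the signed area. *)
Lemma det3_sqr a b c : 4 * det3 a b c ^+ 2 =
  4 * (sqdist b c * sqdist a c) - (sqdist b c + sqdist a c - sqdist a b) ^+ 2.
Proof. by rewrite /det3 /sqdist; ring. Qed.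

Lemma area_gt0 K : triangle K -> 0 < area K.
Proof. by move=> [a [b [c [-> D]]]]; rewrite areaE normr_gt0. Qed.

Lemma area_le_diam K : triangle K -> area K <= diam K ^+ 2.
Proof.
move=> [a [b [c [EK D]]]]; rewrite {1}EK areaE -(@ler_pXn2r _ 2) ?nnegrE ?normr_ge0 ?sqr_ge0 //.
rewrite real_normK ?num_real // -/(det3 a b c).
have H u v : u \in K -> v \in K -> sqdist u v <= diam K ^+ 2.
  by move=> uK vK; rewrite -sqr_edist ler_pXn2r ?nnegrE ?edist_ge0 ?diam_ge0 // diam_ge.
have Hbc : sqdist b c <= diam K ^+ 2 by apply: H; rewrite EK !inE eqxx ?orbT.
have Hac : sqdist a c <= diam K ^+ 2 by apply: H; rewrite EK !inE eqxx ?orbT.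
have := det3_sqr a b c; have := sqr_ge0 (sqdist b c + sqdist a c - sqdist a b).
have : sqdist b c * sqdist a c <= diam K ^+ 2 * diam K ^+ 2.
  by apply: ler_pM => //; apply: sqdist_ge0.
rewrite -expr2; lra.
Qed.

Lemma diam_gt0 K : triangle K -> 0 < diam K.
Proof.
move=> tK; rewrite lt_neqAle diam_ge0 andbT eq_sym; apply/eqP => K0.
have := area_le_diam tK; rewrite K0 expr0n /= => H.
by have := lt_le_trans (area_gt0 tK) H; rewrite ltxx.
Qed.

Lemma child_triangle K e N : triangle K -> longest_edge e K -> N \in children K e ->
  [/\ triangle N, area N = area K / 2, diam K <= 2 * diam N
    & forall v u, v \in N -> u \in K -> `|v - u| <= diam K].
Proof.
move=> tK eK NK; have [a [b [c [EK D abK _ EN]]]] := children_triangle tK eK NK.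
split.
- by exists a, (mid a b), c; split=> //; rewrite -/(det3 _ _ _) det3_mid mulf_neq0.
- by rewrite EK EN !areaE det3_mid normrM (@ger0_norm _ 2^-1).
- rewrite -abK edistE.
  have -> : sqdist a b = 2 ^+ 2 * sqdist a (mid a b) by rewrite sqdist_mid; field.
  rewrite sqrtrM ?sqr_ge0 // sqrtr_sqr ger0_norm // -edistE ler_pM2l //.
  by apply: diam_ge; rewrite EN !inE eqxx ?orbT.
- have H v u : v \in K -> u \in K -> `|v - u| <= diam K.
    by move=> vK uK; apply: le_trans (norm_le_edist v u) _; apply: diam_ge.
  have [aK bK cK] : [/\ a \in K, b \in K & c \in K] by rewrite EK !inE !eqxx ?orbT.
  move=> v u; rewrite EN !inE => /orP[/orP[]|]/eqP-> uK; [exact: H| |exact: H].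
  have -> : mid a b - u = 2^-1 *: ((a - u) + (b - u)).
    by apply/rowP => i; rewrite !mxE; field.
  rewrite normrZ gtr0_norm ?invr_gt0 // mulrC ler_pdivrMr //.
  by apply: le_trans (ler_normD _ _) _; rewrite mulrDr mulr1 lerD // H.
Qed.

(** Were [K'] no larger than [K], the shared edge, of length [diam K], would be longest in [K']
    too. *)
Lemma neighbor_diam_lt T K K' e : triangle K -> longest_edge e K ->
  neighbor T K e K' -> ~ longest_edge e K' -> diam K < diam K'.
Proof.
move=> tK eK [_ _ eK'] H; rewrite ltNge; apply/negP => le; apply: H.
by apply: longest_edge_of_diam; rewrite ?(longest_edge_diam eK).
Qed.

End Plane.

(** * Finitely many scales *)

Section Regular.
Variable R : realType.
Implicit Types (a b c : plane R) (e K N : simplex R) (T : mesh R).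

Definition tau : R := Num.sqrt 2.

Lemma tau_gt0 : 0 < tau.
Proof. by rewrite sqrtr_gt0. Qed.

Lemma sqr_tau : tau ^+ 2 = 2.
Proof. exact: sqr_sqrtr. Qed.

(** A ratio of at most 3/4 makes a geometric series sum to at most 4 times its first term; this is
    the 4 of [geo_down]. *)
Lemma tau_ge : 4 / 3 <= tau.
Proof.
by rewrite -(@ler_pXn2r _ 2) ?nnegrE ?(ltW tau_gt0) // ?sqr_tau; lra.
Qed.

Definition shape (g : nat) a b c : seq R :=
  srt (2 ^+ g * sqdist a b) (2 ^+ g * sqdist b c) (2 ^+ g * sqdist a c).

Lemma shape_rot g a b c : shape g b c a = shape g a b c.
Proof. by rewrite /shape (sqdistC c a) (sqdistC b a) srtC23 srtC12. Qed.

Lemma shapeC12 g a b c : shape g b a c = shape g a b c.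
Proof. by rewrite /shape (sqdistC b a) srtC23. Qed.

Lemma shape_relabel g a b c a' b' c' :
  [fset a; b; c]%fset = [fset a'; b'; c']%fset -> det3 a' b' c' != 0 ->
  shape g a b c = shape g a' b' c'.
Proof.
move=> E D; have [ab ac bc] := det3_neq D.
have [] : [/\ a' \in [fset a; b; c]%fset, b' \in [fset a; b; c]%fset &
    c' \in [fset a; b; c]%fset] by rewrite E !inE !eqxx !orbT.
have C23 x y z : shape g x z y = shape g x y z by rewrite -shape_rot shapeC12 shape_rot.
rewrite !inE => /orP[/orP[]|]/eqP Ea /orP[/orP[]|]/eqP Eb /orP[/orP[]|]/eqP Ec;
  move: ab ac bc; rewrite Ea Eb Ec ?eqxx // => _ _ _.
- by rewrite shapeC12.
- exact/esym/shape_rot.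
- exact: shape_rot.
- rewrite [RHS]shapeC12; exact/esym/shape_rot.
Qed.

Lemma shape_fin_reach a b c : det3 a b c != 0 -> fin_reach (shape 0 a b c).
Proof.
move=> D; have [ab _ _] := det3_neq D; rewrite /shape expr0 !mul1r.
have D2 : 0 < det3 a b c ^+ 2 by rewrite exprn_even_gt0 //= D.
have := det3_sqr a b c => E; apply: fin_reach_triangle.
  rewrite lt_neqAle sqdist_ge0 andbT eq_sym; apply: contra_neq ab => /eqP.
  rewrite paddr_eq0 ?sqr_ge0 // !sqrf_eq0 !subr_eq0 => /andP[/eqP H0 /eqP H1].
  exact: plane_eq.
by rewrite /heron -E mulr_gt0.
Qed.

Lemma seq_lower_bound (l : seq R) : (forall x, x \in l -> 0 < x) ->
  exists2 m, 0 < m & forall x, x \in l -> m <= x.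
Proof.
elim: l => [|y l IH] H; first by exists 1.
have [m m0 Hm] := IH (fun x xl => H x (mem_behead (s := y :: l) xl)).
exists (Num.min y m); first by rewrite lt_min m0 H ?mem_head.
by move=> x; rewrite inE ge_min => /orP[/eqP->|/Hm ->]; rewrite ?lexx ?orbT.
Qed.

Lemma mesh_shapes T : (forall K, K \in T -> triangle K) -> exists U : seq (seq R),
  (forall u, u \in U -> fin_reach u) /\
  (forall K, K \in T -> exists a b c, [/\ K = [fset a; b; c]%fset, det3 a b c != 0 &
     shape 0 a b c \in U]).
Proof.
move=> HT; suff : forall l : seq (simplex R), (forall K, K \in l -> triangle K) ->
    exists U : seq (seq R), (forall u, u \in U -> fin_reach u) /\
  (forall K, K \in l -> exists a b c, [/\ K = [fset a; b; c]%fset, det3 a b c != 0 &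
     shape 0 a b c \in U]) by apply.
elim=> [|K l IH] H; first by exists [::].
have [U [HU HK]] := IH (fun x xl => H x (mem_behead (s := K :: l) xl)).
have [a [b [c [E D]]]] := H K (mem_head _ _).
exists (shape 0 a b c :: U); split=> [u|K'].
  by rewrite inE => /orP[/eqP->|/HU //]; apply: shape_fin_reach.
rewrite inE => /orP[/eqP->|/HK[a' [b' [c' [E' D' HU']]]]].
  by exists a, b, c; split=> //; rewrite mem_head.
by exists a', b', c'; split=> //; rewrite inE HU' orbT.
Qed.

(** [g] counts the bisections since the initial mesh; multiplying by [2 ^ g] recovers the area of
    the initial ancestor. *)
Definition descends (U : seq (seq R)) (A : seq R) K := exists g a b c,
  [/\ K = [fset a; b; c]%fset, det3 a b c != 0, 2 ^+ g * area K \in A &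
      exists2 u, u \in U & reach u (shape g a b c)].

(** Halving the longest edge quarters its squared length. Together with the extra factor 2 of the
    new generation and the median formula this gives the entries of [reach_step]. *)
Lemma descends_child U A K e N :
  descends U A K -> longest_edge e K -> N \in children K e -> descends U A N.
Proof.
move=> [g [a' [b' [c' [E' D' HA [u uU Hu]]]]]] eK NK.
have tK : triangle K by exists a', b', c'.
have [a [b [c [E D abK Ee EN]]]] := children_triangle tK eK NK.
rewrite -(shape_relabel g (a := a) (b := b) (c := c)) -?E // in Hu.
have [_ AN _ _] := child_triangle tK eK NK.
exists g.+1, a, (mid a b), c; split=> //.
- by rewrite det3_mid mulf_neq0.
- by rewrite AN exprS (_ : 2 * _ * _ = 2 ^+ g * area K) //; field.
exists u => //.
have H p q : p \in K -> q \in K -> 2 ^+ g * sqdist p q <= 2 ^+ g * sqdist a b.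
  move=> pK qK; rewrite ler_pM2l ?exprn_gt0 // -!sqr_edist abK.
  by rewrite ler_pXn2r ?nnegrE ?edist_ge0 ?diam_ge0 // diam_ge.
have [aK bK cK] : [/\ a \in K, b \in K & c \in K] by rewrite E !inE !eqxx !orbT.
move: Hu; rewrite /shape srtC23 => /(reach_step (H _ _ aK cK) (H _ _ bK cK)).
congr (reach _ _); rewrite srtC12 [RHS]srtC23 sqdist_mid sqdist_median exprS.
by congr srt; field.
Qed.

Lemma descends_triangle U A K : descends U A K -> triangle K.
Proof. by move=> [g [a [b [c [E D _ _]]]]]; exists a, b, c. Qed.

(** [2 ^ g * diam K ^+ 2] is an entry of a reachable shape and [2 ^ g * area K] an initial area.
    Both range over finite sets, and the powers of 2 cancel in their ratio, which gives [kappa]. *)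
Lemma regular_family T : (forall K, K \in T -> triangle K) ->
  exists (P : simplex R -> Prop) (S D : seq R) (kappa : R),
  [/\ 0 < kappa, (forall s, s \in S -> 0 < s), (forall d, d \in D -> 0 < d),
      (forall K, K \in T -> P K) &
   [/\ (forall K e N, P K -> longest_edge e K -> N \in children K e -> P N),
       (forall K, P K -> triangle K),
       (forall K, P K -> kappa * diam K ^+ 2 <= area K),
       (forall K, P K -> exists k s, s \in S /\ diam K = s / tau ^+ k) &
       (forall K, P K -> exists k d, d \in D /\ area K = (d / tau ^+ k) ^+ 2)]].
Proof.
move=> HT; have [U [HU HUT]] := mesh_shapes HT.
have [F HF] := fin_reach_seq HU.
pose A := [seq area K | K <- T].
pose V := [seq x <- flatten F | 0 < x].
have A0 x : x \in A -> 0 < x by move=> /mapP[K /HT/area_gt0 ? ->].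
have [m m0 Hm] := seq_lower_bound A0.
pose M := 1 + seqmax V.
have M0 : 0 < M by rewrite ltr_wpDr // seqmax_ge0.
have tau0 k : 0 < tau ^+ k by rewrite exprn_gt0 // tau_gt0.
have tau2 k : tau ^+ k ^+ 2 = 2 ^+ k by rewrite exprAC sqr_tau.
have diamV g a b c K : K = [fset a; b; c]%fset -> det3 a b c != 0 ->
    (exists2 u, u \in U & reach u (shape g a b c)) -> 2 ^+ g * diam K ^+ 2 \in V.
  move=> E D [u uU /(HF _ _ uU) sF].
  have tK : triangle K by exists a, b, c.
  have K0 := diam_gt0 tK.
  rewrite mem_filter mulr_gt0 ?exprn_gt0 //=.
  apply/flattenP; exists (shape g a b c) => //.
  have [p [q [pK qK Epq]]] := diam_mem (triangle_neq0 tK).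
  have pq : p != q.
    apply: contraTneq K0 => pq; rewrite Epq pq edistE /sqdist !subrr expr0n addr0.
    by rewrite sqrtr0 ltxx.
  have [r [Er Dr]] := triangle_third tK pK qK pq.
  rewrite (@shape_relabel g a b c p q r) -?E //.
  by rewrite mem_srt Epq sqr_edist mem_head.
exists (descends U A), [seq Num.sqrt x | x <- V], [seq Num.sqrt x | x <- A], (m / M).
split.
- by rewrite divr_gt0.
- by move=> s /mapP[x]; rewrite mem_filter => /andP[x0 _] ->; rewrite sqrtr_gt0.
- by move=> s /mapP[x /A0 x0 ->]; rewrite sqrtr_gt0.
- move=> K KT; have [a [b [c [E D H]]]] := HUT K KT.
  exists 0%N, a, b, c; split=> //; first by rewrite expr0 mul1r; apply: map_f.
  by exists (shape 0 a b c) => //; apply: reach_refl.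
split.
- exact: descends_child.
- exact: descends_triangle.
- move=> K [g [a [b [c [E D HA /(diamV _ _ _ _ _ E D) /seqmax_ge dV]]]]].
  rewrite -(@ler_pM2l _ (2 ^+ g)) ?exprn_gt0 //; apply: le_trans (Hm _ HA).
  rewrite mulrCA -mulrA ler_piMr ?(ltW m0) // mulrC ler_pdivrMr // mul1r.
  by apply: le_trans dV _; rewrite lerDr.
- move=> K [g [a [b [c [E D HA /(diamV _ _ _ _ _ E D) dV]]]]].
  exists g, (Num.sqrt (2 ^+ g * diam K ^+ 2)); split; first exact: map_f.
  rewrite -tau2 -exprMn sqrtr_sqr ger0_norm ?mulr_ge0 ?diam_ge0 ?(ltW (tau0 _)) //.
  by rewrite mulrAC mulfV ?mul1r // gt_eqF.
- move=> K [g [a [b [c [E D HA _]]]]].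
  exists g, (Num.sqrt (2 ^+ g * area K)); split; first exact: map_f.
  have A0' : 0 <= area K by apply: seqmax_ge0.
  rewrite exprMn exprVn tau2 sqr_sqrtr ?mulr_ge0 ?exprn_ge0 //.
  by rewrite mulrAC mulfV ?mul1r // gt_eqF ?exprn_gt0.
Qed.

End Regular.

(** * Disjointness *)

Section OpenTriangles.
Variable R : realType.
Implicit Types (a b c x y : plane R) (e K N : simplex R) (T S : mesh R).

Lemma big_fset3 (V : nmodType) a b c (F : plane R -> V) :
  det3 a b c != 0 -> \sum_(v <- [fset a; b; c]%fset) F v = F a + F b + F c.
Proof.
move=> /det3_neq[ab ac bc].
have p : perm_eq [fset a; b; c]%fset [:: a; b; c].
  apply: uniq_perm; [exact: fset_uniq|by rewrite /= !inE negb_or ab ac bc|].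
  by move=> x; rewrite !inE orbA.
by rewrite (perm_big _ p) /= !big_cons big_nil addr0 addrA.
Qed.

Definition inner K x : Prop := exists w : plane R -> R,
  [/\ forall v, v \in K -> 0 < w v, \sum_(v <- K) w v = 1
    & x = \sum_(v <- K) w v *: v].

Lemma innerP a b c x : det3 a b c != 0 ->
  (inner [fset a; b; c]%fset x <-> exists s t u : R,
     [/\ 0 < s, 0 < t, 0 < u, s + t + u = 1 & x = s *: a + t *: b + u *: c]).
Proof.
move=> D; have [ab ac bc] := det3_neq D; split.
  move=> [w [w0]]; rewrite !big_fset3 // => w1 ->; exists (w a), (w b), (w c).
  by split=> //; apply: w0; rewrite !inE eqxx ?orbT.
move=> [s [t [u [s0 t0 u0 E ->]]]].
exists (fun v => if v == a then s else if v == b then t else u).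
rewrite !big_fset3 // !eqxx (eq_sym b a) (eq_sym c a) (eq_sym c b).
rewrite (negbTE ab) (negbTE ac) (negbTE bc); split=> // v _.
by case: ifP => _ //; case: ifP.
Qed.

Lemma inner_hull K : inner K `<=` hull K.
Proof. by move=> x [w [w0 w1 ->]]; exists w; split=> // v /w0/ltW. Qed.

Lemma affine_unique a b c (s t u s' t' u' : R) : det3 a b c != 0 ->
  s + t + u = 1 -> s' + t' + u' = 1 ->
  s *: a + t *: b + u *: c = s' *: a + t' *: b + u' *: c -> s = s' /\ t = t'.
Proof.
move=> D E E' H.
have H0 := congr1 (fun x : plane R => x 0 0) H.
have H1 := congr1 (fun x : plane R => x 0 1) H.
move: H0 H1; rewrite !mxE => H0 H1.
have Es : s = 1 - t - u by lra. have Es' : s' = 1 - t' - u' by lra.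
have Dt : (t - t') * det3 a b c = 0.
  rewrite /det3; transitivity ((s * a 0 0 + t * b 0 0 + u * c 0 0 -
    (s' * a 0 0 + t' * b 0 0 + u' * c 0 0)) * (c 0 1 - a 0 1) -
    (s * a 0 1 + t * b 0 1 + u * c 0 1 - (s' * a 0 1 + t' * b 0 1 + u' * c 0 1))
      * (c 0 0 - a 0 0)); first by rewrite Es Es'; ring.
  by rewrite H0 H1 !subrr !mul0r subrr.
have Du : (u - u') * det3 a b c = 0.
  rewrite /det3; transitivity ((s * a 0 1 + t * b 0 1 + u * c 0 1 -
    (s' * a 0 1 + t' * b 0 1 + u' * c 0 1)) * (b 0 0 - a 0 0) -
    (s * a 0 0 + t * b 0 0 + u * c 0 0 - (s' * a 0 0 + t' * b 0 0 + u' * c 0 0))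
      * (b 0 1 - a 0 1)); first by rewrite Es Es'; ring.
  by rewrite H0 H1 !subrr !mul0r subrr.
move: Dt Du => /eqP + /eqP; rewrite !mulf_eq0 (negbTE D) !orbF !subr_eq0.
by move=> /eqP Et /eqP Eu; split=> //; lra.
Qed.

Lemma inner_ball a b c x y (s t u mu : R) : det3 a b c != 0 ->
  mu <= s -> mu <= t -> mu <= u -> s + t + u = 1 ->
  x = s *: a + t *: b + u *: c ->
  4 * `|y - x| * diam [fset a; b; c]%fset < mu * area [fset a; b; c]%fset ->
  inner [fset a; b; c]%fset y.
Proof.
set K := [fset a; b; c]%fset; move=> D ms mt mu_u E Ex; rewrite areaE => H.
have D0 : 0 < `|det3 a b c| by rewrite normr_gt0.
(* Cramer's rule: [p] and [q] are the coordinates of [y - x] along [b - a] and [c - a]. Both are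
   below [mu / 2] in absolute value, so the barycentric coordinates stay positive. *)
pose d := y - x; pose p := (d 0 0 * (c 0 1 - a 0 1) - d 0 1 * (c 0 0 - a 0 0)) / det3 a b c.
pose q := (d 0 1 * (b 0 0 - a 0 0) - d 0 0 * (b 0 1 - a 0 1)) / det3 a b c.
have vb v i : v \in K -> `|v 0 i - a 0 i| <= diam K.
  move=> vK; have := coord_le_norm (v - a) i; rewrite !mxE => /le_trans; apply.
  by apply: le_trans (norm_le_edist _ _) _; apply: diam_ge; rewrite // !inE eqxx.
have bound (f g : 'I_2 -> R) : (forall i, `|f i| <= diam K) ->
    2 * `|(d 0 0 * f 1 - d 0 1 * f 0) / det3 a b c| < mu.
  move=> Hf; rewrite normrM normfV mulrA ltr_pdivrMr //; apply: le_lt_trans H.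
  rewrite -[4]/(2 * 2)%:R natrM -!mulrA ler_pM2l //; apply: le_trans (ler_normB _ _) _.
  rewrite !normrM mulr_natl mulr2n lerD // ler_pM // coord_le_norm //.
have bK : b \in K by rewrite !inE eqxx orbT.
have cK : c \in K by rewrite !inE eqxx orbT.
have p2 : 2 * `|p| < mu by apply: (bound (fun i => c 0 i - a 0 i)) => // i; apply: vb.
have q2 : 2 * `|q| < mu.
  have := bound (fun i => - (b 0 i - a 0 i)) (fun=> 0); rewrite !mulrN opprK addrC.
  by apply=> i; rewrite normrN; apply: vb.
have [p3 p4] : - `|p| <= p /\ p <= `|p| by split; rewrite ?lerNnormlW ?ler_norm // lerNl -normrN ler_norm.
have [q3 q4] : - `|q| <= q /\ q <= `|q| by split; rewrite ?lerNnormlW ?ler_norm // lerNl -normrN ler_norm.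
apply/innerP => //; exists (s - p - q), (t + p), (u + q); split; [lra|lra|lra|lra|].
have -> : y = x + d by rewrite /d addrC subrK.
have D' : (b 0 0 - a 0 0) * (c 0 1 - a 0 1) - (c 0 0 - a 0 0) * (b 0 1 - a 0 1) != 0 by [].
have Es : s = 1 - t - u by lra.
by apply: plane_eq; rewrite Ex /p /q /det3 Es; move: (d) => z; rewrite !mxE; field.
Qed.

Lemma inner_interior K : triangle K -> inner K `<=` (hull K)°.
Proof.
move=> tK; have dK := diam_gt0 tK; have aK := area_gt0 tK.
case: tK dK aK => a [b [c [-> D]]] dK aK x.
move=> /(innerP _ D)[s [t [u [s0 t0 u0 E Ex]]]].
set K0 := [fset a; b; c]%fset in dK aK *.
pose mu := Num.min s (Num.min t u).
have mu0 : 0 < mu by rewrite !lt_min s0 t0 u0.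
apply/nbhs_ballP; exists (mu * area K0 / (4 * diam K0)) => /=.
  by rewrite divr_gt0 ?mulr_gt0.
move=> y; rewrite -ball_normE /= distrC ltr_pdivlMr ?mulr_gt0 // => H.
apply: inner_hull; apply: (inner_ball (s := s) (t := t) (u := u) (mu := mu) D) Ex _ => //.
- by rewrite ge_min lexx.
- by rewrite !ge_min lexx orbT.
- by rewrite !ge_min lexx !orbT.
- by rewrite (mulrC 4) -mulrA.
Qed.

Lemma inner_child K e N : triangle K -> longest_edge e K -> N \in children K e ->
  inner N `<=` inner K.
Proof.
move=> tK eK NK; have [a [b [c [-> D _ _ ->]]]] := children_triangle tK eK NK.
have D' : det3 a (mid a b) c != 0 by rewrite det3_mid mulf_neq0.
move=> x /(innerP _ D')[s [t [u [s0 t0 u0 E ->]]]]; apply/innerP => //.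
exists (s + t / 2), (t / 2), u; split=> //; [lra|lra|lra|].
by apply/rowP => i; rewrite !mxE; field.
Qed.

(** The median from [c] separates the children: the barycentric coordinate of [a] exceeds that of
    [b] inside one and is smaller inside the other. *)
Lemma inner_children K e N N' x : triangle K -> longest_edge e K ->
  N \in children K e -> N' \in children K e -> inner N x -> inner N' x -> N = N'.
Proof.
move=> tK eK NK; have [a [b [c [-> D _ Ee EN]]]] := children_triangle tK eK NK.
have [ab ac bc] := det3_neq D; rewrite Ee childrenE // in_fset2 => /orP[]/eqP->.
  by move=> _ _; rewrite EN.
rewrite EN -/(mid a b).
have D' : det3 a (mid a b) c != 0 by rewrite det3_mid mulf_neq0.
have D2 : det3 (mid a b) b c != 0.
  have -> : mid a b = mid b a by rewrite /mid addrC.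
  by rewrite det3C12 det3_mid oppr_eq0 mulf_neq0 // det3C12 oppr_eq0.
move=> /(innerP _ D')[s [t [u [s0 t0 u0 E ->]]]].
move=> /(innerP _ D2)[s' [t' [u' [s0' t0' u0' E' H]]]]; exfalso.
have [] := @affine_unique a b c (s + t / 2) (t / 2) u (s' / 2) (t' + s' / 2) u' D.
- by lra.
- by lra.
- transitivity (s *: a + t *: mid a b + u *: c).
    by apply/rowP => i; rewrite !mxE; field.
  by rewrite H; apply/rowP => i; rewrite !mxE; field.
- lra.
Qed.

(* Implies that the triangles of [T] have disjoint interiors; unlike the
   topological interior of [hull], [inner] is handled by linear algebra alone. *)
Definition mesh_disjoint T := forall K K' x, K \in T -> K' \in T ->
  inner K x -> inner K' x -> K = K'.

Lemma conforming_disjoint T : conforming T -> mesh_disjoint T.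
Proof.
move=> [HT HI _] K K' x KT KT' xK xK'; apply/eqP/negPn/negP => ne.
suff : set0 x by [].
by rewrite -(HI K K' KT KT' ne); split; apply: inner_interior => //; apply: HT.
Qed.

Lemma inner_nonempty K : triangle K -> exists x, inner K x.
Proof.
move=> [a [b [c [-> D]]]]; exists (3^-1 *: a + 3^-1 *: b + 3^-1 *: c).
by apply/innerP => //; exists 3^-1, 3^-1, 3^-1; split; rewrite ?invr_gt0 //; lra.
Qed.

Lemma mem_bisect T S e N : (N \in bisect T S e) <->
  (N \in T /\ N \notin S) \/ (exists2 K, K \in S & N \in children K e).
Proof.
rewrite /bisect inE in_fsetD; split.
  case/orP => [/andP[-> ->]|/bigfcupP[K /andP[KS _] NK]]; first by left.
  by right; exists K.
case=> [[-> ->]//|[K KS NK]]; apply/orP; right; apply/bigfcupP.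
by exists K => //; rewrite KS.
Qed.

Lemma bisect_disjoint T S e : mesh_disjoint T -> (S `<=` T)%fset ->
  (forall K, K \in S -> triangle K /\ longest_edge e K) ->
  mesh_disjoint (bisect T S e).
Proof.
move=> dT /fsubsetP ST HS N N' x /mem_bisect[[NT NS]|[K KS NK]]
  /mem_bisect[[NT' NS']|[K' KS' NK']] xN xN'.
- exact: dT xN xN'.
- have [tK eK] := HS _ KS'; move: NS.
  by rewrite (dT _ _ x NT (ST _ KS') xN (inner_child tK eK NK' xN')) KS'.
- have [tK eK] := HS _ KS; move: NS'.
  by rewrite -(dT _ _ x (ST _ KS) NT' (inner_child tK eK NK xN) xN') KS.
- have [tK eK] := HS _ KS; have [tK' eK'] := HS _ KS'.
  have EK := dT _ _ x (ST _ KS) (ST _ KS') (inner_child tK eK NK xN) (inner_child tK' eK' NK' xN').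
  by rewrite -EK in NK'; apply: inner_children tK eK NK NK' xN xN'.
Qed.

End OpenTriangles.

(** * Path lengths and packing *)

Section Counting.
Variable R : realType.
Implicit Types (a b c p : plane R) (x : R) (e K N : simplex R) (T S : mesh R).
Local Notation tau := (tau R).

Lemma geo_down n (a x : R) : 0 <= a -> 0 <= x ->
  \sum_(k < n | a / tau ^+ k <= x) a / tau ^+ k <= 4 * x.
Proof.
have t0 := tau_gt0 R; have t43 := tau_ge R.
rewrite big_mkcond /=; elim: n a x => [|n IH] a x a0 x0.
  by rewrite big_ord0 mulr_ge0.
have at0 : 0 <= a / tau by rewrite divr_ge0 // ltW.
have Ek k : a / tau ^+ k.+1 = a / tau / tau ^+ k by rewrite exprS invfM mulrA.
rewrite big_ord_recl expr0 divr1.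
under eq_bigr => k _ do rewrite /= /bump /= add1n Ek.
have a3 : 4 * (a / tau) <= 3 * a.
  rewrite mulrCA -[leRHS]mulrC ler_wpM2l // ler_pdivrMr //; lra.
case: (leP a x) => ax /=; last by rewrite add0r; apply: IH.
apply: (@le_trans _ _ (a + 4 * (a / tau))); last by lra.
(* All later terms are at most [a / tau], so this value may replace [x] in the induction
   hypothesis. *)
rewrite lerD2l; apply: le_trans (IH _ _ at0 at0); apply: ler_sum => k _.
have -> : a / tau / tau ^+ k <= a / tau.
  by rewrite ler_pdivrMr ?exprn_gt0 // ler_peMr // exprn_ege1 //; lra.
by case: ifP => _ //; rewrite divr_ge0 // exprn_ge0 // ltW.
Qed.

Lemma geo_up n (a x : R) : 0 <= a -> 0 <= x ->
  \sum_(k < n | a * tau ^+ k <= x) a * tau ^+ k <= 4 * x.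
Proof.
have t0 := tau_gt0 R; case: n => [|n] a0 x0; first by rewrite big_ord0 mulr_ge0.
rewrite (reindex_inj rev_ord_inj) /=.
have E (k : 'I_n.+1) : a * tau ^+ (n.+1 - k.+1) = a * tau ^+ n / tau ^+ k.
  rewrite subSS -mulrA; congr (_ * _).
  have kn : (k <= n)%N := ltnSE (ltn_ord k).
  by rewrite -[LHS](@mulfK _ (tau ^+ k)) ?gt_eqF ?exprn_gt0 // -exprD subnK.
under eq_bigl => k do rewrite E; under eq_bigr => k _ do rewrite E.
by apply: geo_down => //; rewrite mulr_ge0 // exprn_ge0 // ltW.
Qed.

(* Telescopes along a path whose diameters strictly increase and all have the form
   [s / tau ^+ k] with [s \in sc] and [k < n]; see [scale_sum_gap]. *)
Definition scale_sum (sc : seq R) (n : nat) (x : R) : R :=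
  \sum_(s <- sc) \sum_(k < n | s / tau ^+ k <= x) s / tau ^+ k.

Lemma scale_sum_ge0 sc n x : (forall s, s \in sc -> 0 < s) -> 0 <= scale_sum sc n x.
Proof.
move=> sc0; rewrite /scale_sum big_seq; apply: sumr_ge0 => s /sc0 s0.
by apply: sumr_ge0 => k _; rewrite divr_ge0 // ?(ltW s0) // exprn_ge0 // ltW ?tau_gt0.
Qed.

Lemma scale_sum_le sc n x : (forall s, s \in sc -> 0 < s) -> 0 <= x ->
  scale_sum sc n x <= (4 * (size sc)%:R) * x.
Proof.
move=> sc0 x0; rewrite /scale_sum; elim: sc sc0 => [|s sc IH] sc0.
  by rewrite big_nil mulr0 mul0r.
rewrite big_cons /= -[(size sc).+1%:R]natr1 mulrDr mulr1 mulrDl addrC lerD //.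
  by apply: IH => u usc; apply: sc0; rewrite inE usc orbT.
by apply: geo_down => //; rewrite ltW // sc0 // mem_head.
Qed.

(** The term [s / tau ^+ k] is counted at itself but not yet at the smaller [x]; all other terms are
    monotone. *)
Lemma scale_sum_gap sc n s k x : (forall s, s \in sc -> 0 < s) ->
  s \in sc -> (k < n)%N -> x < s / tau ^+ k ->
  scale_sum sc n x + s / tau ^+ k <= scale_sum sc n (s / tau ^+ k).
Proof.
move=> sc0 ssc kn; set y := s / tau ^+ k => xy.
have term0 u m : u \in sc -> 0 <= u / tau ^+ m.
  by move=> /sc0 u0; rewrite divr_ge0 // ?(ltW u0) // exprn_ge0 // ltW ?tau_gt0.
have mono u (m : 'I_n) : u \in sc -> (if u / tau ^+ m <= x then u / tau ^+ m else 0)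
    <= (if u / tau ^+ m <= y then u / tau ^+ m else 0).
  move=> usc; case: ifP => ux; last by case: ifP => // _; apply: term0.
  by rewrite (le_trans ux (ltW xy)).
rewrite /scale_sum !(big_rem s ssc) /= addrAC lerD //; last first.
  rewrite !big_seq; apply: ler_sum => u /mem_rem usc.
  by rewrite big_mkcond [leRHS]big_mkcond; apply: ler_sum => m _; apply: mono.
rewrite big_mkcond [leRHS]big_mkcond /= (bigD1 (Ordinal kn)) //=.
rewrite [leRHS](bigD1 (Ordinal kn)) //= -/y lexx (lt_geF xy) add0r addrC lerD2l.
by apply: ler_sum => m _; apply: mono.
Qed.

Definition regular (P : simplex R -> Prop) (sc ac : seq R) (kappa : R) : Prop :=
  [/\ 0 < kappa, (forall s, s \in sc -> 0 < s), (forall d, d \in ac -> 0 < d),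
      (forall K, P K -> triangle K) &
   [/\ (forall K e N, P K -> longest_edge e K -> N \in children K e -> P N),
       (forall K, P K -> kappa * diam K ^+ 2 <= area K),
       (forall K, P K -> exists k s, s \in sc /\ diam K = s / tau ^+ k) &
       (forall K, P K -> exists k d, d \in ac /\ area K = (d / tau ^+ k) ^+ 2)]].

Lemma vertex_dist K v w : v \in K -> w \in K -> `|v - w| <= diam K.
Proof. by move=> vK wK; apply: le_trans (norm_le_edist _ _) (diam_ge vK wK). Qed.

Lemma lepp_dist P sc ac kappa T Omega M e S :
  regular P sc ac kappa -> (forall K, K \in T -> P K) -> M \in T ->
  lepp Omega T M e S ->
  (S `<=` T)%fset /\ forall K, K \in S -> [/\ longest_edge e K, diam M <= diam K &
    forall v w, v \in M -> w \in K -> `|v - w| <= (2 + 4 * (size sc)%:R) * diam K].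
Proof.
move=> [_ sc0 _ Ptri [_ _ Psc _]] TP MT.
(* A common bound for the exponents in the finite mesh [T] makes [scale_sum] a finite sum; the final
   constant is independent of it. *)
have [n Hn] : exists n, forall K, K \in T -> exists k s,
    [/\ s \in sc, (k < n)%N & diam K = s / tau ^+ k].
  suff [n Hn] : exists n, forall K, K \in enum_fset T -> exists k s,
    [/\ s \in sc, (k < n)%N & diam K = s / tau ^+ k] by exists n.
  elim: (enum_fset T) (fun K (h : K \in enum_fset T) => TP K h) => [|K l IH] Hl.
    by exists 0%N.
  have [n Hn] := IH (fun K' h => Hl K' (mem_behead (s := K :: l) h)).
  have [k [s [ssc Es]]] := Psc K (Hl K (mem_head _ _)).
  exists (maxn n k.+1) => K'; rewrite inE => /orP[/eqP->|/Hn[k' [s' [? kn ?]]]].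
    by exists k, s; split=> //; rewrite leq_max leqnn orbT.
  by exists k', s'; split=> //; rewrite leq_max kn.
pose psi := scale_sum sc n.
(* Each step to a larger neighbor costs at most [diam K], which the increase of [psi] covers; hence
   the difference of [psi] at both ends in the induction. *)
suff main : lepp Omega T M e S -> (S `<=` T)%fset /\ forall K, K \in S ->
    [/\ longest_edge e K, diam M <= diam K & forall v w, v \in M -> w \in K ->
       `|v - w| <= 2 * diam K + psi (diam K) - psi (diam M)].
  move=> /main[ST HS]; split=> // K KS; have [eK MK vw] := HS K KS; split=> //.
  move=> v w vM wK; apply: le_trans (vw v w vM wK) _.
  have := @scale_sum_le sc n (diam K) sc0 (diam_ge0 _).
  have := @scale_sum_ge0 sc n (diam M) sc0.
  rewrite -/psi; lra.
move=> H; elim: H MT => {M e S} [K e eK _|K K' e eK _ nb eK'|K K' e e' S eK _ nb neK' _ IH] KT.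
- split; first by apply/fsubsetP => x; rewrite inE => /eqP->.
  move=> K1; rewrite inE => /eqP->; split=> // v w vK wK.
  have := vertex_dist vK wK; have := diam_ge0 K; lra.
- have [K'T _ eoK'] := nb.
  split; first by apply/fsubsetP => x; rewrite !inE => /orP[]/eqP->.
  have DE : diam K' = diam K by rewrite -(longest_edge_diam eK) (longest_edge_diam eK').
  have D0 := diam_ge0 K.
  move=> K1; rewrite !inE => /orP[]/eqP->; rewrite ?DE; split=> // v w vK wK.
    by have := vertex_dist vK wK; lra.
  have [/segmentP[a [b [_ Ee]]] sub] := eoK'.
  have ae : a \in e by rewrite Ee !inE eqxx.
  have aK' : a \in K' by apply: (fsubsetP sub).
  have aK : a \in K by apply: (fsubsetP eK.1.2).
  have := ler_distD a v w; have := vertex_dist vK aK; have := vertex_dist aK' wK.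
  by rewrite DE; lra.
- have [K'T _ eoK'] := nb; have [ST HS] := IH K'T; split=> // K1 K1S.
  have [e'K1 K'K1 vw] := HS K1 K1S.
  have lt := neighbor_diam_lt (Ptri _ (TP _ KT)) eK nb neK'.
  split=> // [|v w vK wK]; first by apply: le_trans K'K1; apply: ltW.
  have [/segmentP[a [b [_ Ee]]] sub] := eoK'.
  have ae : a \in e by rewrite Ee !inE eqxx.
  have aK' : a \in K' by apply: (fsubsetP sub).
  have aK : a \in K by apply: (fsubsetP eK.1.2).
  have := ler_distD a v w; have := vertex_dist vK aK; have := vw a w aK' wK.
  have [k [s [ssc kn DE]]] := Hn K' K'T; rewrite DE in lt.
  have := scale_sum_gap sc0 ssc kn lt; rewrite -DE -/psi; rewrite -DE in lt.
  by have := diam_ge0 K; lra.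
Qed.

Lemma int_offset (o j : int) (m : nat) : o - m%:Z <= j -> j <= o + m%:Z ->
  exists2 u : nat, (u < (m + m).+1)%N & o - m%:Z + u%:Z = j.
Proof. by move=> H1 H2; exists (absz (j - (o - m%:Z))%R); lia. Qed.

Lemma packing (kappa rho : R) : 0 < kappa -> 0 < rho -> exists n : nat,
  forall (l : seq (simplex R)) (r : R) p, 0 < r -> uniq l ->
    (forall K, K \in l -> [/\ triangle K, area K = r ^+ 2 &
       kappa * diam K ^+ 2 <= area K]) ->
    (forall K K' y, K \in l -> K' \in l -> inner K y -> inner K' y -> K = K') ->
    (forall K, K \in l -> exists2 v, v \in K & `|v - p| <= rho * r) ->
  (size l <= n)%N.
Proof.
move=> k0 rho0; pose q := Num.sqrt kappa; have q0 : 0 < q by rewrite sqrtr_gt0.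
have q2 : q ^+ 2 = kappa by rewrite sqr_sqrtr // ltW.
(* The ball around the barycenter of radius [h], the mesh width of [grid], lies in
   the triangle, which therefore contains a grid point of its own. *)
pose th := q / 13; have th0 : 0 < th by rewrite divr_gt0.
(* Barycenters lie within [(q^-1 + rho) * r] of [p], which is [B - 1] grid steps; [m] leaves room
   for rounding both points to the grid. *)
pose B := (th + q^-1 + rho) / th.
pose m := (Num.truncn B).+2; pose n := (m + m).+1.
exists (n * n)%N => l r p r0 ul Hl Hd Hp.
pose h := th * r; have h0 : 0 < h by rewrite mulr_gt0.
pose grid (ij : int * int) : plane R :=
  \row_k ((if k == 0 then ij.1 else ij.2)%:~R * h).
pose ofs i := Num.floor (p 0 i / h).
have nearby (z : R) i : `|z - p 0 i| <= (q^-1 + rho) * r ->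
    exists2 u : nat, (u < n)%N & `|(ofs i - m%:Z + u%:Z)%:~R * h - z| <= h.
  move=> zp; pose j := Num.floor (z / h).
  have /andP[j1 j2] := floor_itv (z / h).
  have /andP[w1 w2] := floor_itv (p 0 i / h).
  have zB : `|z / h - p 0 i / h| <= B - 1.
    rewrite -mulrBl normrM (@gtr0_norm _ h^-1) ?invr_gt0 // ler_pdivrMr //.
    apply: le_trans zp _; rewrite /B /h.
    by rewrite (_ : (_ - 1) * _ = (q^-1 + rho) * r) //; field; rewrite !gt_eqF.
  have Bm : B < m%:R - 1.
    by rewrite /m -[_.+2%:R]natr1 addrK truncnS_gt.
  move: j1 j2 w1 w2; rewrite -/j -/(ofs i) !intrD => j1 j2 w1 w2.
  move: zB; rewrite ler_norml => /andP[zB1 zB2].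
  have jo1 : (ofs i - m%:Z <= j)%R.
    rewrite -(ler_int R) intrB; change ((Posz m)%:~R : R) with (m%:R : R); lra.
  have jo2 : (j <= ofs i + m%:Z)%R.
    rewrite -(ler_int R) intrD; change ((Posz m)%:~R : R) with (m%:R : R); lra.
  have [u un Eu] := int_offset jo1 jo2; exists u => //; rewrite Eu.
  have zh : z = z / h * h by rewrite divfK // gt_eqF.
  rewrite {1}zh -mulrBl normrM (gtr0_norm h0) ler_piMl ?(ltW h0) //.
  rewrite ler_norml; lra.
have /choice[f Hf] : forall K, exists uv : nat * nat, K \in l ->
    [/\ (uv.1 < n)%N, (uv.2 < n)%N &
      inner K (grid (ofs 0 - m%:Z + uv.1%:Z, ofs 1 - m%:Z + uv.2%:Z))].
  move=> K; case: (boolP (K \in l)) => [Kl|_]; last by exists (0%N, 0%N).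
  have [tK aK dK] := Hl K Kl; have [v vK vp] := Hp K Kl.
  have [a [b [c [EK D]]]] := tK.
  have dr : diam K <= q^-1 * r.
    rewrite ler_pdivlMl // -(@ler_pXn2r _ 2) ?nnegrE ?mulr_ge0 ?diam_ge0 ?(ltW q0) ?(ltW r0) //.
    by rewrite exprMn q2 -aK.
  pose g : plane R := 3^-1 *: a + 3^-1 *: b + 3^-1 *: c.
  have gv : `|g - v| <= diam K.
    have -> : g - v = 3^-1 *: ((a - v) + (b - v) + (c - v)).
      by apply/rowP => i; rewrite !mxE; field.
    rewrite normrZ gtr0_norm ?invr_gt0 // mulrC ler_pdivrMr //.
    have [aK' bK cK] : [/\ a \in K, b \in K & c \in K] by rewrite EK !inE !eqxx !orbT.
    have := vertex_dist aK' vK; have := vertex_dist bK vK; have := vertex_dist cK vK.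
    have := ler_normD (a - v + (b - v)) (c - v); have := ler_normD (a - v) (b - v); lra.
  have gp i : `|g 0 i - p 0 i| <= (q^-1 + rho) * r.
    have := coord_le_norm (g - p) i; have := ler_distD v g p; rewrite !mxE; lra.
  have [u un Hu] := nearby _ _ (gp 0); have [w wn Hw] := nearby _ _ (gp 1).
  exists (u, w) => _; split=> //=; rewrite EK.
  have [ab ac bc] := det3_neq D.
  apply: (inner_ball (s := 3^-1) (t := 3^-1) (u := 3^-1) (mu := 3^-1) D) => //; first by lra.
  rewrite -EK aK; have gh : `|grid (ofs 0 - m%:Z + u%:Z, ofs 1 - m%:Z + w%:Z) - g| <= h.
    by apply: norm_leP; [exact: ltW| |]; rewrite mxE [X in X + _]mxE [X in _ + X]mxE.
  (* At the barycenter [inner_ball] requires [4 * h * diam K < area K / 3]; the 13 in [th] works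
     because [4 / 13 < 1 / 3]. *)
  apply: (@le_lt_trans _ _ (4 * h * (q^-1 * r))).
    by apply: ler_pM; rewrite ?mulr_ge0 ?diam_ge0 // ler_pM2l.
  have -> : 4 * h * (q^-1 * r) = 4 / 13 * r ^+ 2.
    by rewrite /h /th; field; rewrite gt_eqF.
  by rewrite ltr_pM2r ?exprn_gt0 //; lra.
have -> : (n * n = size [seq (u, v) | u <- iota 0 n, v <- iota 0 n])%N.
  by rewrite size_allpairs !size_iota.
rewrite -(size_map f); apply: uniq_leq_size.
  rewrite map_inj_in_uniq // => K K' Kl Kl' EK.
  have [_ _ iK] := Hf K Kl; have [_ _ iK'] := Hf K' Kl'.
  by apply: Hd Kl Kl' iK _; rewrite EK.
move=> _ /mapP[K Kl ->]; have [u0 v0 _] := Hf K Kl.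
by apply/allpairsP; exists (f K); rewrite !mem_iota !add0n u0 v0; split=> //; case: (f K).
Qed.

End Counting.

(** * Amortization *)

Section Amortization.
Variable R : realType.
Implicit Types (e K N M : simplex R) (T S : mesh R) (E Ms : seq (simplex R)).
Local Notation tau := (tau R).

(** An arbitrary vertex that stands for [K] in distance estimates. *)
Definition anchor K : plane R := nth 0 K 0%N.

Lemma anchor_mem K : triangle K -> anchor K \in K.
Proof. by move=> /triangle_neq0; rewrite -cardfs_gt0; apply: mem_nth. Qed.

Definition charge (rho : R) K M : R :=
  if (`|anchor K - anchor M| <= rho * diam K) && (diam M <= 2 * diam K)
  then diam M / diam K else 0.

Lemma charge_ge0 rho K M : 0 <= charge rho K M.
Proof. by rewrite /charge; case: ifP => // _; rewrite divr_ge0 ?diam_ge0. Qed.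

(** Elements are grouped by area [r ^+ 2]. By [packing] at most [n] of a group are charged, each at
    most [diam M / r]; this ratio is at most [X] whenever a charge is nonzero, so [geo_up] sums the
    groups. *)
Lemma charge_sum_le P sc ac kappa rho : regular P sc ac kappa -> 0 < rho ->
  exists2 C : R, 0 <= C & forall E M, uniq E -> (forall K, K \in E -> P K) ->
    (forall K K' x, K \in E -> K' \in E -> area K = area K' ->
       inner K x -> inner K' x -> K = K') ->
    \sum_(K <- E) charge rho K M <= C.
Proof.
move=> [k0 _ ac0 Ptri [_ Pk _ Pac]] rho0.
pose q := Num.sqrt kappa; have q0 : 0 < q by rewrite sqrtr_gt0.
have q2 : q ^+ 2 = kappa by rewrite sqr_sqrtr // ltW.
have [n Hn] := packing k0 (divr_gt0 rho0 q0).
pose X := 2 / q; have X0 : 0 < X by rewrite divr_gt0.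
exists ((size ac)%:R * (n%:R * (4 * X))); first by do 3 (apply: mulr_ge0; rewrite ?ler0n //); apply: ltW.
move=> E M uE EP Edisj.
have [m Hm] : exists m, forall K, K \in E -> exists k d,
    [/\ d \in ac, (k < m)%N & area K = (d / tau ^+ k) ^+ 2].
  elim: E EP {uE Edisj} => [|K l IH] Hl; first by exists 0%N.
  have [m Hm] := IH (fun K' h => Hl K' (mem_behead (s := K :: l) h)).
  have [k [d [dac Ed]]] := Pac K (Hl K (mem_head _ _)).
  exists (maxn m k.+1) => K'; rewrite inE => /orP[/eqP->|/Hm[k' [d' [? km ?]]]].
    by exists k, d; split=> //; rewrite leq_max leqnn orbT.
  by exists k', d'; split=> //; rewrite leq_max km.
(* An area may have several representations; overcounting is harmless as charges are nonnegative. *)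
have step1 : \sum_(K <- E) charge rho K M <= \sum_(K <- E) \sum_(d <- ac) \sum_(k < m)
    (if area K == (d / tau ^+ k) ^+ 2 then charge rho K M else 0).
  rewrite !big_seq; apply: ler_sum => K KE.
  have [k [d [dac km Ed]]] := Hm K KE.
  have pos (b : bool) : 0 <= if b then charge rho K M else 0.
    by case: b => //; apply: charge_ge0.
  rewrite (big_rem d dac) /= (bigD1 (Ordinal km)) //= Ed eqxx -addrA lerDl.
  by apply: addr_ge0; apply: sumr_ge0 => // i _; apply: sumr_ge0.
apply: le_trans step1 _; rewrite exchange_big /=.
have step2 d : d \in ac -> \sum_(K <- E) \sum_(k < m)
    (if area K == (d / tau ^+ k) ^+ 2 then charge rho K M else 0) <= n%:R * (4 * X).
  move=> dac; have d0 := ac0 _ dac; rewrite exchange_big /=.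
  have M0 : 0 <= diam M / d by rewrite divr_ge0 ?diam_ge0 // ltW.
  apply: le_trans (ler_wpM2l (ler0n R n) (geo_up m M0 (ltW X0))).
  rewrite mulr_sumr big_mkcond /= [leRHS]big_mkcond /=; apply: ler_sum => k _.
  have [r rE] : exists r, r = d / tau ^+ k by exists (d / tau ^+ k).
  have r0 : 0 < r by rewrite rE divr_gt0 // exprn_gt0 // tau_gt0.
  have Er : diam M / d * tau ^+ k = diam M / r.
    by rewrite rE invfM invrK mulrA.
  rewrite Er -rE -big_mkcond -big_filter /=.
  pose good K := (area K == r ^+ 2) && (charge rho K M != 0).
  have goodP K : K \in E -> good K -> [/\ diam K <= r / q, r <= diam K,
      charge rho K M = diam M / diam K,
      `|anchor K - anchor M| <= rho * diam K & diam M <= 2 * diam K].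
    move=> /EP PK /andP[/eqP aK]; rewrite /charge; case: ifP => [/andP[? ?] _|_].
      split=> //.
        rewrite ler_pdivlMr // -(@ler_pXn2r _ 2) ?nnegrE ?mulr_ge0 ?diam_ge0 ?(ltW q0) ?(ltW r0) //.
        by rewrite exprMn q2 mulrC -aK; apply: Pk.
      rewrite -(@ler_pXn2r _ 2) ?nnegrE ?diam_ge0 ?(ltW r0) // -aK.
      exact: area_le_diam (Ptri _ PK).
    by rewrite eqxx.
  have -> : \sum_(K <- [seq K <- E | area K == r ^+ 2]) charge rho K M =
      \sum_(K <- [seq K <- E | good K]) charge rho K M.
    rewrite !big_filter big_mkcond [RHS]big_mkcond /=; apply: eq_bigr => K _.
    by rewrite /good; case: eqP => //= _; case: eqP.
  have sz : (size [seq K <- E | good K] <= n)%N.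
    apply: (Hn _ r (anchor M)) => //; first exact: filter_uniq.
    - move=> K; rewrite mem_filter => /andP[/andP[/eqP aK _] /EP PK].
      by split=> //; [apply: Ptri|apply: Pk].
    - move=> K K' x; rewrite !mem_filter => /andP[/andP[/eqP aK _] KE].
      move=> /andP[/andP[/eqP aK' _] KE']; apply: Edisj => //; by rewrite aK aK'.
    - move=> K; rewrite mem_filter => /andP[gK KE].
      have [Kr _ _ KM _] := goodP _ KE gK.
      exists (anchor K); first exact/anchor_mem/Ptri/EP.
      by apply: le_trans KM _; rewrite mulrAC -mulrA ler_pM2l.
  case: (leP (diam M / r) X) => HX.
    apply: (@le_trans _ _ (\sum_(K <- [seq K <- E | good K]) (diam M / r))).
      rewrite !big_seq; apply: ler_sum => K; rewrite mem_filter => /andP[gK KE].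
      have [_ rK -> _ _] := goodP _ KE gK.
      rewrite ler_wpM2l ?diam_ge0 // lef_pV2 // posrE //.
      exact: lt_le_trans rK.
    rewrite big_const_seq count_predT iter_addr addr0 -[leLHS]mulr_natl.
    by rewrite ler_wpM2r ?divr_ge0 ?diam_ge0 ?(ltW r0) // ler_nat.
  rewrite big_seq big1 // => K; rewrite mem_filter => /andP[gK KE].
  have [Kr _ _ _ KM] := goodP _ KE gK; exfalso.
  move: HX; rewrite ltNge ler_pdivrMr // => /negP; apply.
  apply: le_trans KM _; rewrite /X -mulrA ler_pM2l // mulrC.
  by apply: le_trans Kr _.
have -> : (size ac)%:R * (n%:R * (4 * X)) = \sum_(d <- ac) n%:R * (4 * X).
  by rewrite big_const_seq count_predT iter_addr addr0 mulr_natl.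
by rewrite !big_seq; apply: ler_sum => d /step2.
Qed.

End Amortization.

(** * Invariant of the refinement runs *)

Lemma card_bigfcup_le (R : realType) (s : seq (simplex R)) (F : simplex R -> mesh R) n :
  (forall K, K \in s -> (#|` F K| <= n)%N) ->
  (#|` \bigcup_(K <- s) F K|%fset <= n * size s)%N.
Proof.
elim: s => [|K s IH] H; first by rewrite big_nil cardfs0.
rewrite big_cons mulnS; apply: leq_trans (leq_card_fsetU _ _) _.
rewrite leq_add ?H ?mem_head // IH // => K' K's.
by apply: H; rewrite inE K's orbT.
Qed.

Section Run.
Variable R : realType.
Implicit Types (e K N M : simplex R) (T S : mesh R) (E Ms : seq (simplex R)).
Variables (P : simplex R -> Prop) (sc ac : seq R) (kappa : R).
Hypothesis reg : regular P sc ac kappa.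

(* [reach_const] bounds the distance from [M] to a terminal triangle [K] of a
   propagation path starting at [M], [hop_const] the distance from [M] to the
   children of [K], and [radius] leaves room for both. *)
Definition reach_const : R := 2 + 4 * (size sc)%:R.
Definition hop_const : R := 2 * (1 + reach_const).
Definition radius : R := hop_const + reach_const.

Local Notation charge := (charge radius).

Lemma reach_const_gt0 : 0 < reach_const.
Proof. by rewrite /reach_const; have := ler0n R (size sc); lra. Qed.

Lemma hop_const_gt0 : 0 < hop_const.
Proof. by rewrite /hop_const; have := reach_const_gt0; lra. Qed.

(* By induction along the chain [N], the marked element that created [N], the
   marked element that created that one, and so on: either the chain leaves the
   ball of radius [radius * diam K] around [K], and its hops, of lengths at
   most [hop_const * diam N], pay the claimed amount, or it reaches an element
   of size comparable with [K]. *)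
Definition funded (c1 : R) Ms N := forall K c, P K -> diam N <= 2 * diam K ->
  c <= c1 ->
  c * hop_const * diam K <= radius * diam K - `|anchor K - anchor N| ->
  c <= charge K N + \sum_(M <- Ms) charge K M.

Lemma funded_cons c1 M Ms N : funded c1 Ms N -> funded c1 (M :: Ms) N.
Proof.
move=> H K c PK NK c1c cK; apply: le_trans (H K c PK NK c1c cK) _.
by rewrite lerD2l big_cons lerDr charge_ge0.
Qed.

Lemma charge_sum_ge0 Ms K N : 0 <= charge K N + \sum_(M <- Ms) charge K M.
Proof. by rewrite addr_ge0 ?charge_ge0 ?sumr_ge0 // => M _; apply: charge_ge0. Qed.

(** A positive claim [c] forces [N] into the ball of radius [radius * diam K]. *)
Lemma charge_near K N c : P K -> diam N <= 2 * diam K -> 0 < c ->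
  c * hop_const * diam K <= radius * diam K - `|anchor K - anchor N| ->
  charge K N = diam N / diam K.
Proof.
move=> PK NK c0 H; rewrite /charge NK andbT ifT //.
have [_ _ _ Ptri _] := reg; have K0 := diam_gt0 (Ptri _ PK).
have : 0 < c * hop_const * diam K by rewrite mulr_gt0 // mulr_gt0 // hop_const_gt0.
lra.
Qed.

Lemma funded_initial c1 N : (forall K, P K -> c1 * diam K <= diam N) ->
  funded c1 [::] N.
Proof.
move=> H K c PK NK cc1 cK; have [c0|c0] := leP c 0.
  exact: le_trans c0 (charge_sum_ge0 _ _ _).
have [_ _ _ Ptri _] := reg; have K0 := diam_gt0 (Ptri _ PK).
rewrite (charge_near PK NK c0 cK) big_nil addr0 ler_pdivlMr //.
by apply: le_trans (H K PK); rewrite ler_pM2r.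
Qed.

(** If [N] is at least as large as [K], it pays the claim alone. Otherwise it pays
    [diam N / diam K], and the hop to [M] uses up [hop_const * diam N] of the distance reserve, just
    what the reduced claim on [M] allows. *)
Lemma funded_child c1 Ms M N (h : R) : c1 <= 1 -> funded c1 Ms M -> diam M <= h ->
  h <= 2 * diam N -> `|anchor M - anchor N| <= (1 + reach_const) * h ->
  funded c1 (M :: Ms) N.
Proof.
move=> c11 HM Mh hN MN K c PK NK cc1 cK; have [c0|c0] := leP c 0.
  exact: le_trans c0 (charge_sum_ge0 _ _ _).
have [_ _ _ Ptri _] := reg; have K0 := diam_gt0 (Ptri _ PK).
rewrite (charge_near PK NK c0 cK).
have S0 : 0 <= \sum_(M' <- M :: Ms) charge K M'.
  by apply: sumr_ge0 => M' _; apply: charge_ge0.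
have [KN|NK'] := leP (diam K) (diam N).
  have : 1 <= diam N / diam K by rewrite ler_pdivlMr // mul1r.
  by lra.
rewrite -lerBlDl big_cons; apply: HM => //; first by lra.
  have : 0 <= diam N / diam K by rewrite divr_ge0 ?diam_ge0.
  by lra.
have hop : `|anchor M - anchor N| <= hop_const * diam N.
  rewrite /hop_const mulrAC (mulrC _ (1 + _)); apply: le_trans MN _.
  by rewrite ler_pM2l //; have := reach_const_gt0; lra.
have := ler_distD (anchor N) (anchor K) (anchor M).
rewrite (distrC (anchor N)).
have -> : (c - diam N / diam K) * hop_const * diam K =
    c * hop_const * diam K - hop_const * diam N by field; rewrite gt_eqF.
by lra.
Qed.

(* [Ms] lists the marked elements treated so far and [E] the elements bisected. *)
Record state (c1 : R) (T0 : mesh R) T Ms E : Prop := State {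
  state_mesh : forall N, N \in T -> P N;
  state_disjoint : mesh_disjoint T;
  state_funded : forall N, N \in T -> funded c1 Ms N;
  state_uniq : uniq E;
  state_bisected : forall K, K \in E -> P K;
  state_dead : forall K N x, K \in E -> N \in T -> inner K x -> inner N x ->
    area N < area K;
  state_separated : forall K K' x, K \in E -> K' \in E -> area K = area K' ->
    inner K x -> inner K' x -> K = K';
  state_paid : forall K, K \in E -> c1 <= \sum_(M <- Ms) charge K M;
  state_card : (#|` T| <= #|` T0| + size E)%N }.

Lemma state_cons c1 T0 T M Ms E : state c1 T0 T Ms E -> state c1 T0 T (M :: Ms) E.
Proof.
move=> [? ? HF ? ? ? ? HP ?]; split=> //.
  by move=> N NT; apply: funded_cons; apply: HF.
by move=> K KE; apply: le_trans (HP K KE) _; rewrite big_cons lerDr charge_ge0.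
Qed.

(** [M] is funded relative to the list before its own treatment, so that its charge becomes the head
    of the sum over [M :: Ms] and is not counted twice. *)
Lemma state_bisect c1 T0 Omega T M Ms E e S : c1 <= 1 ->
  funded c1 Ms M -> M \in T -> state c1 T0 T (M :: Ms) E -> lepp Omega T M e S ->
  exists E', state c1 T0 (bisect T S e) (M :: Ms) E'.
Proof.
move=> c11 HM MT st lp; case: st => TP Td Tf uE EP Edead Esep Epaid Tcard.
have [_ _ _ Ptri [Pch _ _ _]] := reg.
have [ST HS] := lepp_dist reg TP MT lp; have /fsubsetP ST' := ST.
have SP K : K \in S -> P K by move=> /ST'/TP.
have longS K : K \in S -> longest_edge e K by move=> /HS[].
have child K N : K \in S -> N \in children K e ->
    [/\ triangle N, area N = area K / 2, diam K <= 2 * diam N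
    & forall v u, v \in N -> u \in K -> `|v - u| <= diam K].
  by move=> KS NK; apply: child_triangle NK; [apply/Ptri/SP|apply: longS].
have sub K N : K \in S -> N \in children K e -> inner N `<=` inner K.
  by move=> KS; apply: inner_child; [apply/Ptri/SP|apply: longS].
have area0 K : P K -> 0 < area K by move=> /Ptri/area_gt0.
exists (enum_fset S ++ E); split.
- move=> N /mem_bisect[[NT _]|[K KS NK]]; first exact: TP.
  by apply: Pch NK; [apply: SP|apply: longS].
- by apply: bisect_disjoint => // K KS; split; [apply/Ptri/SP|apply: longS].
- move=> N /mem_bisect[[NT _]|[K KS NK]]; first exact: Tf.
  have [_ MK far] := HS K KS; have [tN _ dN near] := child K N KS NK.
  apply: (funded_child (h := diam K)) => //.
  have tK := Ptri _ (SP _ KS); have tM := Ptri _ (TP _ MT).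
  have := ler_distD (anchor K) (anchor M) (anchor N); rewrite mulrDl mul1r.
  have : `|anchor M - anchor K| <= reach_const * diam K.
    exact: far (anchor_mem tM) (anchor_mem tK).
  have := near _ _ (anchor_mem tN) (anchor_mem tK).
  by rewrite (distrC (anchor N) (anchor K)); lra.
(* An element bisected earlier and present again would have smaller area than itself. *)
- rewrite cat_uniq fset_uniq uE andbT /=; apply/hasPn => K KE; apply/negP => KS.
  have [x xK] := inner_nonempty (Ptri _ (EP _ KE)).
  by have := Edead K K x KE (ST' _ KS) xK xK; rewrite ltxx.
- by move=> K; rewrite mem_cat => /orP[/SP|/EP].
- move=> K N x; rewrite mem_cat => /orP[KS|KE] /mem_bisect[[NT NS]|[K1 K1S NK1]] xK xN.
  + by move: NS; rewrite (Td N K x NT (ST' _ KS) xN xK) KS.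
  + have -> := Td K K1 x (ST' _ KS) (ST' _ K1S) xK (sub _ _ K1S NK1 _ xN).
    by have [_ -> _ _] := child K1 N K1S NK1; have := area0 _ (SP _ K1S); lra.
  + exact: Edead xK xN.
  + have := Edead K K1 x KE (ST' _ K1S) xK (sub _ _ K1S NK1 _ xN).
    by have [_ -> _ _] := child K1 N K1S NK1; have := area0 _ (SP _ K1S); lra.
- move=> K K' x; rewrite !mem_cat => /orP[KS|KE] /orP[KS'|KE'] aKK xK xK'.
  + exact: Td (ST' _ KS) (ST' _ KS') xK xK'.
  + by have := Edead K' K x KE' (ST' _ KS) xK' xK; rewrite aKK ltxx.
  + by have := Edead K K' x KE (ST' _ KS') xK xK'; rewrite aKK ltxx.
  + exact: Esep xK xK'.
(* Subtracting the distance from [M] to [K] leaves [hop_const * diam K] of the radius, enough for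
   the claim [c1 <= 1]. *)
- move=> K; rewrite mem_cat => /orP[KS|]; last exact: Epaid.
  have [_ MK far] := HS K KS; have K0 := diam_ge0 K.
  rewrite big_cons; apply: HM => //; [exact: SP|lra|].
  have tK := Ptri _ (SP _ KS); have tM := Ptri _ (TP _ MT).
  have : `|anchor M - anchor K| <= reach_const * diam K.
    exact: far (anchor_mem tM) (anchor_mem tK).
  have : c1 * hop_const * diam K <= hop_const * diam K.
    by rewrite ler_wpM2r // ler_piMl // ltW // hop_const_gt0.
  rewrite (distrC (anchor K)) /radius.
  move: hop_const reach_const => hop rch; lra.
(* Each element of [S] gives way to at most two children, so the mesh grows by at most the number of
   elements added to [E]. *)
- rewrite size_cat; apply: leq_trans (leq_card_fsetU _ _) _.
  have -> : #|` T `\` S|%fset = (#|` T| - #|` S|)%N by rewrite cardfsD (fsetIidPr ST).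
  have := @card_bigfcup_le R (enum_fset S) (fun K => children K e) 2.
  move=> /(_ (fun K KS => card_children K (longS K KS).1.1)).
  have := fsubset_leq_card ST; move: Tcard.
  have -> : size (enum_fset S) = #|` S| by [].
  move: (#|` T|) (#|` S|) (#|` T0|) (size E) => t s t0 n.
  by move: #|` _| => u; lia.
Qed.

Lemma state_refine_one c1 T0 Omega M Ms T T' E : c1 <= 1 ->
  funded c1 Ms M -> state c1 T0 T (M :: Ms) E -> refine_one_LEB Omega M T T' ->
  exists E', state c1 T0 T' (M :: Ms) E'.
Proof.
move=> c11 HM + rf; elim: rf E => [T1 _ E st|T1 T2 e S MT lp _ IH E st]; first by exists E.
by have [E' /IH] := state_bisect c11 HM MT st lp.
Qed.

Lemma state_refine_seq c1 T0 Omega s Ms T T' E : c1 <= 1 ->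
  state c1 T0 T Ms E -> refine_LEB_seq Omega s T T' ->
  exists Ms' E', state c1 T0 T' Ms' E' /\ (size Ms' <= size Ms + size s)%N.
Proof.
move=> c11 + rf; elim: rf Ms E => {s T T'} [T|M s T T1 T2 MT r1 _ IH|M s T T1 _ _ IH] Ms E st.
- by exists Ms, E; rewrite addn0.
- have [E1 st1] := state_refine_one c11 (state_funded st MT) (state_cons M st) r1.
  have [Ms' [E' [st' sz]]] := IH _ _ st1; exists Ms', E'; split=> //.
  by rewrite /= addnS -addSn.
- have [Ms' [E' [st' sz]]] := IH _ _ st; exists Ms', E'; split=> //.
  by rewrite /= addnS leqW.
Qed.

End Run.

Theorem theorem1p1 (R : realType) (T0 : mesh R) :
  exists C : R,
    forall Omega : set (plane R),
      polygonal_domain Omega -> mesh_of Omega T0 ->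
      forall (L : nat) (T : nat -> mesh R) (MM : nat -> {fset simplex R}),
        (1 <= L)%N ->
        T 0%N = T0 ->
        (forall l, (l < L)%N -> (MM l `<=` T l)%fset) ->
        (forall l, (l < L)%N -> refine_LEB Omega (T l) (MM l) (T l.+1)) ->
        (#|` T L|%:R - #|` T0|%:R : R) <= C * \sum_(l < L) #|` MM l|%:R.
Proof.
(* The constant is fixed before [Omega]; if [T0] is not conforming, [mesh_of] is contradictory and
   any value serves. *)
have [T0conf|nconf] := pselect (conforming T0); last first.
  by exists 0 => Omega _ [].
have tri : forall K, K \in T0 -> triangle K by case: T0conf.
have [P [sc [ac [kappa [k0 sc0 ac0 T0P [Pch Ptri Pk Psc Pac]]]]]] := regular_family tri.
have reg : regular P sc ac kappa by split.
have rad0 : 0 < radius sc.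
  by rewrite /radius; have := reach_const_gt0 sc; have := hop_const_gt0 sc; lra.
have [C C0 HC] := charge_sum_le reg rad0.
have [m m0 Hm] : exists2 m, 0 < m & forall x, x \in [seq diam K | K <- T0] -> m <= x.
  by apply: seq_lower_bound => _ /mapP[K /tri/diam_gt0 ? ->].
(* [h] bounds all diameters of the family, so [c1 * diam K <= m] funds the initial elements;
   [m <= h] gives [c1 <= 1]. *)
pose h := 1 + m + seqmax sc.
have h0 : 0 < h by rewrite /h; have := seqmax_ge0 sc; lra.
pose c1 := m / h.
have c10 : 0 < c1 by rewrite divr_gt0.
have c11 : c1 <= 1.
  by rewrite ler_pdivrMr // mul1r /h; have := seqmax_ge0 sc; lra.
exists (C / c1) => Omega _ _ L T MM _ ET _ ref.
have [Ms [E [st sz]]] : exists Ms E, state P sc c1 T0 (T L) Ms E /\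
    (size Ms <= \sum_(l < L) #|` MM l|)%N.
  elim: L ref => [|L IH] ref.
    exists [::], [::]; rewrite ET big_ord0; split=> //; split=> //; first last.
    - by rewrite addn0.
    - move=> N NT; apply: (funded_initial reg) => K PK.
      apply: le_trans (Hm _ (map_f _ NT)).
      have [k [s [ssc ->]]] := Psc K PK.
      have t1 : 1 <= (tau R) ^+ k by rewrite exprn_ege1 //; have := tau_ge R; lra.
      rewrite /c1 mulrAC ler_pdivrMr // ler_pM2l //.
      apply: (@le_trans _ _ s); last by have := seqmax_ge ssc; rewrite /h; lra.
      by rewrite ler_pdivrMr ?(lt_le_trans ltr01) // ler_peMr // ltW // sc0.
    - exact: conforming_disjoint.
  have [Ms [E [st sz]]] := IH (fun l lL => ref l (ltnW lL)).
  have [s /perm_size ss rs] := ref L (ltnSn L).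
  have [Ms' [E' [st' sz']]] := state_refine_seq reg c11 st rs.
  exists Ms', E'; split=> //; rewrite big_ord_recr /=.
  by apply: leq_trans sz' _; rewrite -ss leq_add2r.
(* Double counting: every bisected element receives at least [c1], every treated marked element pays
   at most [C]. *)
have Csz : c1 * (size E)%:R <= C * (size Ms)%:R.
  have -> : c1 * (size E)%:R = \sum_(K <- E) c1.
    by rewrite big_const_seq count_predT iter_addr addr0 mulr_natr.
  have -> : C * (size Ms)%:R = \sum_(K <- Ms) C.
    by rewrite big_const_seq count_predT iter_addr addr0 mulr_natr.
  apply: (@le_trans _ _ (\sum_(K <- E) \sum_(M <- Ms) charge (radius sc) K M)).
    by rewrite !big_seq; apply: ler_sum => K KE; apply: state_paid st _ KE.
  rewrite exchange_big /=; apply: ler_sum => M _.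
  apply: HC; [exact: state_uniq st|exact: state_bisected st|exact: state_separated st].
rewrite lerBlDl; apply: (@le_trans _ _ (#|` T0|%:R + (size E)%:R)).
  by rewrite -natrD ler_nat; apply: state_card st.
rewrite lerD2l mulrAC ler_pdivlMr // mulrC; apply: le_trans Csz _.
by rewrite ler_wpM2l // -natr_sum ler_nat.
Qed.
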